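(* Let $\mathcal X\subseteq\mathbb R^d$ be contained in the closure of its interior, let $K\in\mathcal C^{s,s}(\mathcal X\times\mathcal X,\mathbb R^{Q\times Q})$ ($s\in\mathbb N$) be a matrix-valued kernel with vector-valued RKHS $\mathcal F_K$, and let $[I]$ be partitioned into disjoint sets $\mathcal I_{\mathrm{SOC}}$ and $\mathcal I_\Omega$. Let $C\subseteq\mathcal F_K\times\mathbb R^B$ be the original constraint set and $C^i_{P_i,\mathrm{SOC}}$ ($i\in\mathcal I_{\mathrm{SOC}}$), $C^i_{1,\Omega}$ ($i\in\mathcal I_\Omega$) the tightened constraint sets defined in the context, and put $C_{\mathrm{app}}:=\big(\bigcap_{i\in\mathcal I_{\mathrm{SOC}}}C^i_{P_i,\mathrm{SOC}}\big)\cap\big(\bigcap_{i\in\mathcal I_\Omega}C^i_{1,\Omega}\big)$. Let $\hat{\mathcal F}_K$ be a closed subspace of $\mathcal F_K$ equipped with $\|\cdot\|_K$, and $\mathcal L:\mathcal F_K\times\mathbb R^B\to\mathbb R\cup\{\infty\}$. Consider $$(\mathscr P_{\mathrm{app}}):\ \min_{\mathbf f\in\hat{\mathcal F}_K,\ \mathbf b\in\mathbb R^B,\ (\mathbf f,\mathbf b)\in C_{\mathrm{app}}}\mathcal L(\mathbf f,\mathbf b),\qquad(\mathscr P):\ \min_{\mathbf f\in\mathcal F_K,\ \mathbf b\in\mathbb R^B,\ (\mathbf f,\mathbf b)\in C}\mathcal L(\mathbf f,\mathbf b),$$ with optimal values $v_{\mathrm{app}}$ and $\bar v$. Assume that: (i)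 solutions $(\bar{\mathbf f}_{\mathrm{app}},\bar{\mathbf b}_{\mathrm{app}})$ of $(\mathscr P_{\mathrm{app}})$ and $(\bar{\mathbf f},\bar{\mathbf b})$ of $(\mathscr P)$ exist; (ii) $\hat{\mathcal F}_K=\mathcal F_K$ and $\operatorname{dom}(\mathcal L(\bar{\mathbf f},\cdot))=\mathbb R^B$; (iii) there exists $\boldsymbol\beta\in\mathbb R^B$ such that $\boldsymbol\Gamma_i\boldsymbol\beta>\mathbf 0$ (componentwise) for all $i\in[I]$; (iv) $\{\tilde{\mathbf x}_{i,m}\}_{m\in[M_i]}\subseteq\mathscr K_i$ for all $i\in\mathcal I_{\mathrm{SOC}}$; (v) $\mathcal L(\bar{\mathbf f},\cdot)$ is $L_b$-Lipschitz continuous on the closed Euclidean ball of $\mathbb R^B$ with center $\bar{\mathbf b}$ and radius $\eta_\infty c_f\|\boldsymbol\beta\|_2$, where $$c_f:=\frac{\max_{i\in[I]}\|\bar{\mathbf f}-\mathbf f_{0,i}\|_K}{\min_{i\in[I],\,p\in[P_i]}(\boldsymbol\Gamma_i\boldsymbol\beta)_p},\qquad\eta_\infty:=\max\Big(\max_{i\in\mathcal I_{\mathrm{SOC}},\,m\in[M_i]}\eta_{i,m,P_i},\ \max_{i\in\mathcal I_\Omega,\,m\in[M_i]}\operatorname{diam}(\Omega_{i,m})\Big).$$ Then $$0\le v_{\mathrm{app}}-\bar v\le L_b\,c_f\,\|\boldsymbol\beta\|_2\,\eta_\infty .$$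
   Context: $[n]=\{1,\dots,n\}$; $\preccurlyeq$ is the Loewner order; $\mathbf I_P$ the identity; $\mathscr S^{P-1}$ the Euclidean unit sphere of $\mathbb R^P$; $\|\cdot\|_{\mathcal X}$ a fixed norm on $\mathbb R^d$; $\mathbb B_{\mathcal X}(\mathbf c,r)=\{\mathbf x\in\mathcal X:\|\mathbf x-\mathbf c\|_{\mathcal X}\le r\}$; $\operatorname{dom}(g)=\{g<\infty\}$; $\operatorname{diam}$ is the diameter with respect to $\|\cdot\|_K$. Kernels and operators. Matrix-valued kernel: $K(\mathbf x,\mathbf x')=K(\mathbf x',\mathbf x)^\top$ and $\sum_{i,j}\mathbf v_i^\top K(\mathbf x_i,\mathbf x_j)\mathbf v_j\ge0$ for all finite families. $\mathcal F_K$ (inner product $\langle\cdot,\cdot\rangle_K$, norm $\|\cdot\|_K$) is the Hilbert space of functions $\mathcal X\to\mathbb R^Q$ containing all $K(\cdot,\mathbf x)\mathbf c$ with $\langle\mathbf f,K(\cdot,\mathbf x)\mathbf c\rangle_K=\langle\mathbf f(\mathbf x),\mathbf c\rangle$. $\mathcal C^{s,s}$: $\partial^{\mathbf r,\mathbf r}$ (order $\mathbf r$ in each of the two arguments) exists and is continuous for all $|\mathbf r|\le s$ (derivatives at non-interior points are continuous extensions from the interior). $O_{1,s}$: operators $f\mapsto\sum_{j\in J}c_j\partial^{\mathbf r_j}f$, $J$ finite, $|\mathbf r_j|\le s$, $c_j\in\mathbb R$. $O_{Q,s}$: operators $D(\mathbf f)(\mathbf x)=\sum_{q\in[Q]}\beta_qD_q(f_q)(\mathbf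 x)$, $\beta_q\in\mathbb R$, $D_q\in O_{1,s}$. For such $D$, $DK(\mathbf x',\mathbf x):=\sum_q\beta_qD_q[\mathbf x''\mapsto K(\mathbf x',\mathbf x'')](\mathbf x)\mathbf e_q\in\mathbb R^Q$ ($\mathbf e_q$ the $q$-th canonical basis vector of $\mathbb R^Q$); every $\mathbf f\in\mathcal F_K$ is $\mathcal C^s$, $DK(\cdot,\mathbf x)\in\mathcal F_K$ and $D(\mathbf f)(\mathbf x)=\langle\mathbf f,DK(\cdot,\mathbf x)\rangle_K$. Original constraints. For $i\in[I]$ we are given a compact set $\mathscr K_i\subseteq\mathcal X$, an integer $P_i\ge1$ with $P_i=1$ if $i\in\mathcal I_\Omega$, $\mathbf D_i=[D^i_{p_1,p_2}]_{p_1,p_2\in[P_i]}$ with $D^i_{p_1,p_2}\in O_{Q,s}$ and $\mathbf D_i(\mathbf f)(\mathbf x)$ always symmetric (for $P_i=1$ write $D_i$), $\mathbf f_{0,i}\in\mathcal F_K$, $\mathbf b_{0,i}\in\mathbb R^{P_i}$ (for $P_i=1$ write $b_{0,i}$), $\boldsymbol\Gamma_i\in\mathbb R^{P_i\times B}$; $$C=\{(\mathbf f,\mathbf b)\in\mathcal F_K\times\mathbb R^B:\ \mathbf 0\preccurlyeq\mathbf D_i(\mathbf f-\mathbf f_{0,i})(\mathbf x)+\operatorname{diag}(\boldsymbol\Gamma_i\mathbf b-\mathbf b_{0,i})\ \forall\mathbf x\in\mathscr K_i,\ \forall i\in[I]\}.$$ Tightened constraints, $i\in\mathcal I_{\mathrm{SOC}}$.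 Fix finitely many $\tilde{\mathbf x}_{i,m}\in\mathcal X$, $\delta_{i,m}>0$ ($m\in[M_i]$) with $\mathscr K_i\subseteq\bigcup_m\mathbb B_{\mathcal X}(\tilde{\mathbf x}_{i,m},\delta_{i,m})$, let $$\eta_{i,m,P_i}=\sup_{\mathbf x\in\mathbb B_{\mathcal X}(\tilde{\mathbf x}_{i,m},\delta_{i,m}),\ \mathbf u\in\mathscr S^{P_i-1}}\Big\|\sum_{p_1,p_2\in[P_i]}u_{p_1}u_{p_2}[D^i_{p_1,p_2}K(\cdot,\tilde{\mathbf x}_{i,m})-D^i_{p_1,p_2}K(\cdot,\mathbf x)]\Big\|_K$$ and let $C^i_{P_i,\mathrm{SOC}}$ be the set of $(\mathbf f,\mathbf b)\in\mathcal F_K\times\mathbb R^B$ with $\eta_{i,m,P_i}\|\mathbf f-\mathbf f_{0,i}\|_K\mathbf I_{P_i}\preccurlyeq\mathbf D_i(\mathbf f-\mathbf f_{0,i})(\tilde{\mathbf x}_{i,m})+\operatorname{diag}(\boldsymbol\Gamma_i\mathbf b-\mathbf b_{0,i})$ for all $m\in[M_i]$. Tightened constraints, $i\in\mathcal I_\Omega$. Fix finitely many non-empty sets $$\Omega_{i,m}=\Big(\bigcap_{j\in[J_{B,i,m}]}\{\mathbf g\in\mathcal F_K:\|\mathbf g-\mathbf c_{i,m,j}\|_K<r_{i,m,j}\}\Big)\cap\Big(\bigcap_{j\in[J_{H,i,m}]}\{\mathbf g\in\mathcal F_K:\langle\mathbf v_{i,m,j},\mathbf g\rangle_K<\rho_{i,m,j}\}\Big),\quad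 m\in[M_i],$$ with $\mathbf c_{i,m,j}\in\mathcal F_K$, $r_{i,m,j}>0$, $\mathbf 0\ne\mathbf v_{i,m,j}\in\mathcal F_K$, $\rho_{i,m,j}\in\mathbb R$, such that $\Phi_{D_i}(\mathscr K_i):=\{D_iK(\cdot,\mathbf x):\mathbf x\in\mathscr K_i\}\subseteq\bigcup_{m\in[M_i]}\overline{\Omega_{i,m}}$. $C^i_{1,\Omega}$ is the set of $(\mathbf f,\mathbf b)\in\mathcal F_K\times\mathbb R^B$ such that for every $m\in[M_i]$ there exist $\mathbf g_j\in\operatorname{span}(\mathbf f-\mathbf f_{0,i},\{\mathbf c_{i,m,l}\}_l,\{\mathbf v_{i,m,l}\}_l)$ ($j\in[J_{B,i,m}]$) and $\xi_j\ge0$ ($j\in[J_{H,i,m}]$) with $$-b_{0,i}+\boldsymbol\Gamma_i\mathbf b+\sum_j\langle\mathbf g_j,\mathbf c_{i,m,j}\rangle_K-\sum_j\xi_j\rho_{i,m,j}-\sum_jr_{i,m,j}\|\mathbf g_j\|_K\ge0,\qquad-(\mathbf f-\mathbf f_{0,i})+\sum_j\mathbf g_j-\sum_j\xi_j\mathbf v_{i,m,j}=\mathbf 0$$ (equivalently, $\Omega_{i,m}\subseteq\{\mathbf g:\langle\mathbf f-\mathbf f_{0,i},\mathbf g\rangle_K\ge b_{0,i}-\boldsymbol\Gamma_i\mathbf b\}$ for all $m$).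
   Formalization: Added assumption: for i in I_Ω, the closure of every Ω_{i,m} meets Φ_{D_i}(K_i); without it a superfluous Ω_{i,m} far from Φ_{D_i}(K_i) makes the upper bound false. The upper bound is stated for η_∞ < ∞ only (otherwise it is trivial or 0·∞). *)

(* Defs.v *)
From HB Require Import structures.
From mathcomp Require Import all_boot all_order all_algebra.
From mathcomp Require Import all_classical all_reals all_analysis.

Set Implicit Arguments.
Unset Strict Implicit.
Unset Printing Implicit Defensive.

Import Order.TTheory GRing.Theory Num.Theory.
Import numFieldNormedType.Exports.

Local Open Scope classical_set_scope.
Local Open Scope ring_scope.

(** * Finite-dimensional preliminaries *)

(* The library norm of ['cV[R]_n] is the sup norm, so the Euclidean structure
   is introduced separately. *)
Definition dotp (R : realType) (n : nat) (u v : 'cV[R]_n) : R :=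
  \sum_(i < n) u i 0 * v i 0.

Definition enorm (R : realType) (n : nat) (u : 'cV[R]_n) : R :=
  Num.sqrt (dotp u u).

Definition is_norm (R : realType) (d : nat) (N : 'rV[R]_d -> R) : Prop :=
  [/\ forall x y, N (x + y) <= N x + N y,
      forall a x, N (a *: x) = `|a| * N x &
      forall x, N x = 0 -> x = 0].

(* Only used between symmetric matrices. *)
Definition loewner_le (R : realType) (n : nat) (A B : 'M[R]_n) : Prop :=
  forall u : 'cV[R]_n, 0 <= (u^T *m (B - A) *m u) 0 0.

(** * Partial derivatives on a set X contained in the closure of its interior *)

(* Functions on X are represented by total functions on R^d: values outside X
   play no role, since derivatives are taken at interior points of X only and
   then extended to X along the interior. *)

Definition pderiv (R : realType) (d : nat) (i : 'I_d) (g : 'rV[R]_d -> R) :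
    'rV[R]_d -> R :=
  'D_(delta_mx 0 i) g.

(* The word in which the index i occurs [r i] times, in increasing order. *)
Definition dirs (d : nat) (r : 'I_d -> nat) : seq 'I_d :=
  flatten [seq nseq (r i) i | i <- enum 'I_d].

Definition mindex_order (d : nat) (r : 'I_d -> nat) : nat := \sum_(i < d) r i.

Definition iter_pderiv (R : realType) (d : nat) (l : seq 'I_d)
    (g : 'rV[R]_d -> R) : 'rV[R]_d -> R :=
  foldr (@pderiv R d) g l.

(* ['D_v] is total; this says that all the successive derivatives in
   [iter_pderiv l g] exist on U. *)
Fixpoint ex_iter_pderiv (R : realType) (d : nat) (U : set 'rV[R]_d)
    (l : seq 'I_d) (g : 'rV[R]_d -> R) : Prop :=
  if l is i :: l' then
    ex_iter_pderiv U l' g /\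
    forall x, U x -> derivable (iter_pderiv l' g) x (delta_mx 0 i)
  else True.

(* d^r g = d_1^{r_1} ... d_d^{r_d} g *)
Definition mpderiv (R : realType) (d : nat) (r : 'I_d -> nat)
    (g : 'rV[R]_d -> R) : 'rV[R]_d -> R :=
  iter_pderiv (dirs r) g.

Definition ex_mpderiv (R : realType) (d : nat) (U : set 'rV[R]_d)
    (r : 'I_d -> nat) (g : 'rV[R]_d -> R) : Prop :=
  ex_iter_pderiv U (dirs r) g.

(* d^r g at a point of X, by continuous extension from the interior of X at
   the non-interior points. *)
Definition mpderiv_on (R : realType) (d : nat) (X : set 'rV[R]_d)
    (r : 'I_d -> nat) (g : 'rV[R]_d -> R) (x : 'rV[R]_d) : R :=
  if x \in (interior X : set _) then mpderiv r g x
  else lim (mpderiv r g y @[y --> within (interior X) (nbhs x)]).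

(** * Kernels *)

Definition is_kernel (R : realType) (d Q : nat) (X : set 'rV[R]_d)
    (K : 'rV[R]_d -> 'rV[R]_d -> 'M[R]_Q) : Prop :=
  (forall x x', X x -> X x' -> K x x' = (K x' x)^T) /\
  (forall (n : nat) (x : 'I_n -> 'rV[R]_d) (v : 'I_n -> 'cV[R]_Q),
     (forall i, X (x i)) ->
     0 <= \sum_(i < n) \sum_(j < n) ((v i)^T *m K (x i) (x j) *m v j) 0 0).

(* d^{r,r} k (x, x') = d_x^r d_{x'}^r k (x, x') *)
Definition mpderiv2 (R : realType) (d : nat) (r : 'I_d -> nat)
    (k : 'rV[R]_d -> 'rV[R]_d -> R) (x x' : 'rV[R]_d) : R :=
  mpderiv r (fun y => mpderiv r (k y) x') x.

Definition ex_mpderiv2 (R : realType) (d : nat) (U : set 'rV[R]_d)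
    (r : 'I_d -> nat) (k : 'rV[R]_d -> 'rV[R]_d -> R) : Prop :=
  (forall y, U y -> ex_mpderiv U r (k y)) /\
  (forall x', U x' -> ex_mpderiv U r (fun y => mpderiv r (k y) x')).

(* C^{s,s}: K is continuous on X x X, and for |r| <= s the derivative d^{r,r} of
   every entry exists on the interior and extends continuously to X x X. *)
Definition kernel_Css (R : realType) (d Q : nat) (s : nat) (X : set 'rV[R]_d)
    (K : 'rV[R]_d -> 'rV[R]_d -> 'M[R]_Q) : Prop :=
  forall a b : 'I_Q,
    {within X `*` X, continuous (fun z : 'rV[R]_d * 'rV[R]_d => K z.1 z.2 a b)} /\
    forall r : 'I_d -> nat, (mindex_order r <= s)%N ->
      ex_mpderiv2 (interior X) r (fun x x' => K x x' a b) /\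
      exists G : 'rV[R]_d * 'rV[R]_d -> R,
        {within X `*` X, continuous G} /\
        forall x x', interior X x -> interior X x' ->
          G (x, x') = mpderiv2 r (fun x x' => K x x' a b) x x'.

(* The vector-valued RKHS of K: a real Hilbert space [rk_sort] whose elements f
   are identified with the functions [rk_ev f] restricted to X.  It is
   determined by K up to a unique isometry compatible with [rk_ev]. *)
Record rkhs (R : realType) (d Q : nat) (X : set 'rV[R]_d)
    (K : 'rV[R]_d -> 'rV[R]_d -> 'M[R]_Q) := Rkhs {
  rk_sort :> completeNormedModType R ;
  rk_ip : rk_sort -> rk_sort -> R ;
  rk_ev : rk_sort -> 'rV[R]_d -> 'cV[R]_Q ;
  rk_ipC : forall f g, rk_ip f g = rk_ip g f ;
  rk_ip_linear : forall a f g h,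
    rk_ip (a *: f + g) h = a * rk_ip f h + rk_ip g h ;
  rk_normE : forall f, `|f| = Num.sqrt (rk_ip f f) ;
  rk_ip_ge0 : forall f, 0 <= rk_ip f f ;
  rk_ev_linear : forall a f g x, X x ->
    rk_ev (a *: f + g) x = a *: rk_ev f x + rk_ev g x ;
  rk_ev_inj : forall f g,
    (forall x, X x -> rk_ev f x = rk_ev g x) -> f = g ;
  rk_reproducing : forall x (c : 'cV[R]_Q), X x ->
    exists k : rk_sort,
      (forall x', X x' -> rk_ev k x' = K x' x *m c) /\
      (forall f, rk_ip f k = dotp (rk_ev f x) c)
}.

(** * Differential operators *)

(* f |-> \sum_j c_j d^{r_j} f with |r_j| <= s, given by the pairs (c_j, r_j). *)
Record diffop1 (R : realType) (d s : nat) := Diffop1 {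
  d1_terms : seq (R * ('I_d -> nat)) ;
  d1_order : all (fun t => (mindex_order t.2 <= s)%N) d1_terms
}.

Definition diffop1_app (R : realType) (d s : nat) (X : set 'rV[R]_d)
    (D : diffop1 R d s) (g : 'rV[R]_d -> R) (x : 'rV[R]_d) : R :=
  \sum_(t <- d1_terms D) t.1 * mpderiv_on X t.2 g x.

(* f |-> \sum_q beta_q D_q (f_q) *)
Record diffop (R : realType) (d Q s : nat) := Diffop {
  do_coef : 'I_Q -> R ;
  do_op : 'I_Q -> diffop1 R d s
}.

Definition diffop_app (R : realType) (d Q s : nat) (X : set 'rV[R]_d)
    (D : diffop R d Q s) (g : 'rV[R]_d -> 'cV[R]_Q) (x : 'rV[R]_d) : R :=
  \sum_(q < Q) do_coef D q * diffop1_app X (do_op D q) (fun y => g y q 0) x.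

(* DK (x', x) = \sum_q beta_q D_q[x'' |-> K (x', x'')](x) e_q, where D_q acts
   entrywise on the matrix K (x', x''). *)
Definition DK (R : realType) (d Q s : nat) (X : set 'rV[R]_d)
    (K : 'rV[R]_d -> 'rV[R]_d -> 'M[R]_Q) (D : diffop R d Q s)
    (x' x : 'rV[R]_d) : 'cV[R]_Q :=
  \sum_(q < Q) do_coef D q *:
    ((\matrix_(a < Q, b < Q)
        diffop1_app X (do_op D q) (fun x'' => K x' x'' a b) x)
     *m delta_mx q 0).

(* The element DK (., x) of the RKHS (unique by [rk_ev_inj]). *)
Definition DKsec (R : realType) (d Q s : nat) (X : set 'rV[R]_d)
    (K : 'rV[R]_d -> 'rV[R]_d -> 'M[R]_Q) (F : rkhs X K) (D : diffop R d Q s)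
    (x : 'rV[R]_d) : F :=
  xget 0 [set g : F | forall x', X x' -> rk_ev g x' = DK X K D x' x].

(** * Original constraints *)

Record shape_constraint (R : realType) (d Q : nat) (X : set 'rV[R]_d)
    (K : 'rV[R]_d -> 'rV[R]_d -> 'M[R]_Q) (F : rkhs X K) (s B : nat) :=
  ShapeConstraint {
    sc_set : set 'rV[R]_d ;
    sc_dim : nat ;
    sc_dim_gt0 : (0 < sc_dim)%N ;
    sc_op : 'I_sc_dim -> 'I_sc_dim -> diffop R d Q s ;
    sc_f0 : F ;
    sc_b0 : 'cV[R]_sc_dim ;
    sc_Gamma : 'M[R]_(sc_dim, B)
  }.

Arguments sc_op {R d Q X K F s B} _ _ _.

(* The index 1 of [P_i]; its only index when P_i = 1. *)
Definition sc_idx (R : realType) (d Q : nat) (X : set 'rV[R]_d)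
    (K : 'rV[R]_d -> 'rV[R]_d -> 'M[R]_Q) (F : rkhs X K) (s B : nat)
    (c : shape_constraint F s B) : 'I_(sc_dim c) :=
  Ordinal (sc_dim_gt0 c).

(* The matrix D_i (f) (x). *)
Definition sc_opmx (R : realType) (d Q : nat) (X : set 'rV[R]_d)
    (K : 'rV[R]_d -> 'rV[R]_d -> 'M[R]_Q) (F : rkhs X K) (s B : nat)
    (c : shape_constraint F s B) (f : F) (x : 'rV[R]_d) : 'M[R]_(sc_dim c) :=
  \matrix_(p1, p2) diffop_app X (sc_op c p1 p2) (rk_ev f) x.

Definition shape_constraint_wf (R : realType) (d Q : nat) (X : set 'rV[R]_d)
    (K : 'rV[R]_d -> 'rV[R]_d -> 'M[R]_Q) (F : rkhs X K) (s B : nat)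
    (c : shape_constraint F s B) : Prop :=
  [/\ compact (sc_set c), sc_set c `<=` X &
      forall (f : F) x, X x -> (sc_opmx c f x)^T = sc_opmx c f x].

(* D_i (f - f_{0,i}) (x) + diag (Gamma_i b - b_{0,i}) *)
Definition sc_mx (R : realType) (d Q : nat) (X : set 'rV[R]_d)
    (K : 'rV[R]_d -> 'rV[R]_d -> 'M[R]_Q) (F : rkhs X K) (s B : nat)
    (c : shape_constraint F s B) (f : F) (b : 'cV[R]_B) (x : 'rV[R]_d) :
    'M[R]_(sc_dim c) :=
  sc_opmx c (f - sc_f0 c) x + diag_mx (sc_Gamma c *m b - sc_b0 c)^T.

Definition C_orig (R : realType) (d Q : nat) (X : set 'rV[R]_d)
    (K : 'rV[R]_d -> 'rV[R]_d -> 'M[R]_Q) (F : rkhs X K) (s B n : nat)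
    (c : 'I_n -> shape_constraint F s B) : set (F * 'cV[R]_B) :=
  [set z | forall i x, sc_set (c i) x -> loewner_le 0 (sc_mx (c i) z.1 z.2 x)].

(** * Second-order cone tightening *)

Definition nball (R : realType) (d : nat) (X : set 'rV[R]_d)
    (N : 'rV[R]_d -> R) (x0 : 'rV[R]_d) (delta : R) : set 'rV[R]_d :=
  [set x | X x /\ N (x - x0) <= delta].

(* The supremum may be +oo when X is not closed. *)
Definition soc_eta (R : realType) (d Q : nat) (X : set 'rV[R]_d)
    (K : 'rV[R]_d -> 'rV[R]_d -> 'M[R]_Q) (F : rkhs X K) (s B : nat)
    (N : 'rV[R]_d -> R) (c : shape_constraint F s B)
    (xt : 'rV[R]_d) (delta : R) : \bar R :=
  ereal_sup [set e | exists x (u : 'cV[R]_(sc_dim c)),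
    [/\ nball X N xt delta x, enorm u = 1 &
        e = (`| \sum_(p1 < sc_dim c) \sum_(p2 < sc_dim c)
                 (u p1 0 * u p2 0) *:
                 (DKsec F (sc_op c p1 p2) xt - DKsec F (sc_op c p1 p2) x) |)%:E]].

(* If the supremum is +oo, the constraint fails unless f = f_{0,i}, in which
   case +oo * 0 = 0. *)
Definition C_soc (R : realType) (d Q : nat) (X : set 'rV[R]_d)
    (K : 'rV[R]_d -> 'rV[R]_d -> 'M[R]_Q) (F : rkhs X K) (s B : nat)
    (N : 'rV[R]_d -> R) (c : shape_constraint F s B) (M : nat)
    (xt : 'I_M -> 'rV[R]_d) (delta : 'I_M -> R) : set (F * 'cV[R]_B) :=
  [set z | forall m : 'I_M,
    let t := (soc_eta N c (xt m) (delta m) * (`|z.1 - sc_f0 c|)%:E)%E in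
    t \is a fin_num /\ loewner_le (fine t)%:M (sc_mx c z.1 z.2 (xt m))].

Definition soc_cover (R : realType) (d Q : nat) (X : set 'rV[R]_d)
    (K : 'rV[R]_d -> 'rV[R]_d -> 'M[R]_Q) (F : rkhs X K) (s B : nat)
    (N : 'rV[R]_d -> R) (c : shape_constraint F s B) (M : nat)
    (xt : 'I_M -> 'rV[R]_d) (delta : 'I_M -> R) : Prop :=
  [/\ forall m, X (xt m), forall m, 0 < delta m &
      sc_set c `<=` \bigcup_m nball X N (xt m) (delta m)].

(** * Tightening by coverings in the RKHS *)

Record omega_data (R : realType) (F : Type) := OmegaData {
  om_nB : nat ;
  om_c : 'I_om_nB -> F ;
  om_r : 'I_om_nB -> R ;
  om_nH : nat ;
  om_v : 'I_om_nH -> F ;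
  om_rho : 'I_om_nH -> R
}.

Arguments om_c {R F} _ _.
Arguments om_r {R F} _ _.
Arguments om_v {R F} _ _.
Arguments om_rho {R F} _ _.

Definition omega_set (R : realType) (d Q : nat) (X : set 'rV[R]_d)
    (K : 'rV[R]_d -> 'rV[R]_d -> 'M[R]_Q) (F : rkhs X K)
    (o : omega_data R F) : set F :=
  [set g | (forall j, `|g - om_c o j| < om_r o j) /\
           (forall j, rk_ip (om_v o j) g < om_rho o j)].

Definition omega_wf (R : realType) (d Q : nat) (X : set 'rV[R]_d)
    (K : 'rV[R]_d -> 'rV[R]_d -> 'M[R]_Q) (F : rkhs X K)
    (o : omega_data R F) : Prop :=
  [/\ forall j, 0 < om_r o j, forall j, om_v o j <> 0 &
      omega_set o !=set0].

(* Phi_{D_i} (K_i), for P_i = 1 *)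
Definition Phi_set (R : realType) (d Q : nat) (X : set 'rV[R]_d)
    (K : 'rV[R]_d -> 'rV[R]_d -> 'M[R]_Q) (F : rkhs X K) (s B : nat)
    (c : shape_constraint F s B) : set F :=
  [set DKsec F (sc_op c (sc_idx c) (sc_idx c)) x | x in sc_set c].

Definition omega_cover (R : realType) (d Q : nat) (X : set 'rV[R]_d)
    (K : 'rV[R]_d -> 'rV[R]_d -> 'M[R]_Q) (F : rkhs X K) (s B : nat)
    (c : shape_constraint F s B) (M : nat) (o : 'I_M -> omega_data R F) : Prop :=
  (forall m, omega_wf (o m)) /\
  Phi_set c `<=` \bigcup_m closure (omega_set (o m)).

(* span (h, {c_l}_l, {v_l}_l) *)
Definition omega_span (R : realType) (d Q : nat) (X : set 'rV[R]_d)
    (K : 'rV[R]_d -> 'rV[R]_d -> 'M[R]_Q) (F : rkhs X K)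
    (o : omega_data R F) (h : F) : set F :=
  [set g | exists (a : R) (al : 'I_(om_nB o) -> R) (ga : 'I_(om_nH o) -> R),
     g = a *: h + \sum_l al l *: om_c o l + \sum_l ga l *: om_v o l].

Definition C_omega (R : realType) (d Q : nat) (X : set 'rV[R]_d)
    (K : 'rV[R]_d -> 'rV[R]_d -> 'M[R]_Q) (F : rkhs X K) (s B : nat)
    (c : shape_constraint F s B) (M : nat) (o : 'I_M -> omega_data R F) :
    set (F * 'cV[R]_B) :=
  [set z | forall m : 'I_M,
    exists (g : 'I_(om_nB (o m)) -> F) (xi : 'I_(om_nH (o m)) -> R),
    [/\ forall j, omega_span (o m) (z.1 - sc_f0 c) (g j),
        forall j, 0 <= xi j,
        0 <= - sc_b0 c (sc_idx c) 0 + (sc_Gamma c *m z.2) (sc_idx c) 0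
             + \sum_j rk_ip (g j) (om_c (o m) j)
             - \sum_j xi j * om_rho (o m) j
             - \sum_j om_r (o m) j * `|g j| &
        - (z.1 - sc_f0 c) + \sum_j g j - \sum_j xi j *: om_v (o m) j = 0]].

Definition ediam (R : realType) (V : normedModType R) (A : set V) : \bar R :=
  ereal_sup [set e | exists x y, [/\ A x, A y & e = (`|x - y|)%:E]].

(** * Optimization problems and the constants of the bound *)

Definition is_minimizer (R : realType) (T : Type) (L : T -> \bar R)
    (S : set T) (z : T) : Prop :=
  S z /\ forall z', S z' -> (L z <= L z')%E.

Definition optval (R : realType) (T : Type) (L : T -> \bar R) (S : set T) :
    \bar R :=
  ereal_inf [set L z | z in S].

Definition closed_subspace (R : realType) (V : normedModType R) (S : set V) :
    Prop :=
  [/\ S 0, forall (a : R) u v, S u -> S v -> S (a *: u + v) & closed S].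

Definition C_app (R : realType) (d Q : nat) (X : set 'rV[R]_d)
    (K : 'rV[R]_d -> 'rV[R]_d -> 'M[R]_Q) (F : rkhs X K) (s B n : nat)
    (N : 'rV[R]_d -> R) (c : 'I_n -> shape_constraint F s B)
    (Isoc Iom : {set 'I_n}) (M : 'I_n -> nat)
    (xt : forall i, 'I_(M i) -> 'rV[R]_d) (delta : forall i, 'I_(M i) -> R)
    (o : forall i, 'I_(M i) -> omega_data R F) : set (F * 'cV[R]_B) :=
  [set z | (forall i, i \in Isoc -> C_soc N (c i) (@xt i) (@delta i) z) /\
           (forall i, i \in Iom -> C_omega (c i) (@o i) z)].

(* The maximum runs over nonnegative reals, and the infimum over a finite set. *)
Definition cf_const (R : realType) (d Q : nat) (X : set 'rV[R]_d)
    (K : 'rV[R]_d -> 'rV[R]_d -> 'M[R]_Q) (F : rkhs X K) (s B n : nat)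
    (c : 'I_n -> shape_constraint F s B) (beta : 'cV[R]_B) (f : F) : R :=
  (\big[Num.max/0]_(i < n) `|f - sc_f0 (c i)|) /
  inf [set y | exists i (p : 'I_(sc_dim (c i))),
               y = (sc_Gamma (c i) *m beta) p 0].

Definition eta_inf (R : realType) (d Q : nat) (X : set 'rV[R]_d)
    (K : 'rV[R]_d -> 'rV[R]_d -> 'M[R]_Q) (F : rkhs X K) (s B n : nat)
    (N : 'rV[R]_d -> R) (c : 'I_n -> shape_constraint F s B)
    (Isoc Iom : {set 'I_n}) (M : 'I_n -> nat)
    (xt : forall i, 'I_(M i) -> 'rV[R]_d) (delta : forall i, 'I_(M i) -> R)
    (o : forall i, 'I_(M i) -> omega_data R F) : \bar R :=
  maxe
    (\big[maxe/0%E]_(i in Isoc) \big[maxe/0%E]_(m < M i)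
        soc_eta N (c i) (xt i m) (delta i m))
    (\big[maxe/0%E]_(i in Iom) \big[maxe/0%E]_(m < M i)
        ediam (omega_set (o i m))).

(* Main.v *)
Require Import Defs.
From HB Require Import structures.
From mathcomp Require Import all_boot all_order all_algebra.
From mathcomp Require Import all_classical all_reals all_analysis.
From mathcomp Require Import ring lra.

(* Two facts carry the bound.
   (1) The tightened constraints imply the original ones, because
   D(f)(x) = <f, DK(., x)> in the RKHS, so that moving x by at most delta
   changes the constraint by at most eta * |f - f0|.  The reproducing property
   of derivatives is obtained from iterated finite differences of the feature
   map x |-> K(., x) e_q: by the mean value theorem, the inner products of two
   such differences are values of the mixed derivative of K at nearby points,
   so continuity of that derivative makes the differences Cauchy in norm.
   (2) Let (fbar, bbar) solve the original problem.  Then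
   (fbar, bbar + eta_inf * cf * beta) satisfies the tightened constraints:
   the shift along beta dominates eta_inf * |fbar - f0_i| in every component.
   For the coverings by Omega this also needs the dual certificate of
   nonnegativity of an affine function on Omega, which exists since the open
   set Omega provides a Slater point.
   The Lipschitz assumption bounds the cost of the shift in (2). *)

Set Implicit Arguments.
Unset Strict Implicit.
Unset Printing Implicit Defensive.

Import Order.TTheory GRing.Theory Num.Theory.
Import numFieldNormedType.Exports.

Local Open Scope classical_set_scope.
Local Open Scope ring_scope.

(** * Lagrange multipliers under Slater's condition *)

Definition cvx_fun (R : realType) (V : lmodType R) (f : V -> R) :=
  forall x y t, 0 <= t <= 1 ->
    f (t *: x + (1 - t) *: y) <= t * f x + (1 - t) * f y.

Definition cvx_set (R : realType) (V : lmodType R) (D : set V) :=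
  forall x y t, 0 <= t <= 1 -> D x -> D y -> D (t *: x + (1 - t) *: y).

(** This stands in for letting [e] tend to 0: taking [e = 1] gives [b >= 0], so if [a < 0] some
    weight makes the mixture equal to [a / 2]. *)
Lemma ge0_of_mix (R : realType) (a b : R) :
  (forall e, 0 < e <= 1 -> 0 <= (1 - e) * a + e * b) -> 0 <= a.
Proof.
move=> H; rewrite leNgt; apply/negP => a0.
have b0 : 0 <= b by have := H 1; lra.
have ba : 0 < b - a by lra.
have := H (- a / (2 * (b - a))).
have -> : (1 - - a / (2 * (b - a))) * a + - a / (2 * (b - a)) * b = a / 2.
  by field; rewrite gt_eqF.
have e0 : 0 < - a / (2 * (b - a)) by apply: divr_gt0; lra.
have e1 : - a / (2 * (b - a)) <= 1 by rewrite ler_pdivrMr; lra.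
by move=> /(_ _); rewrite e0 e1 => /(_ isT); lra.
Qed.

(** The chord of [phi] between [y] and [x] vanishes at the weight [t0]. Slightly nearer to [y],
    convexity makes [phi] negative, hence [f] nonnegative; convexity of [f] and a vanishing
    perturbation then give the inequality up to the factor [phi x - phi y]. *)
Lemma slater_cross (R : realType) (V : lmodType R) (D : set V) (f phi : V -> R)
    (x y : V) :
  cvx_set D -> cvx_fun f -> cvx_fun phi ->
  (forall z, D z -> phi z < 0 -> 0 <= f z) ->
  D x -> D y -> 0 <= phi x -> phi y < 0 -> 0 <= phi x * f y - phi y * f x.
Proof.
move=> cD cf cp H Dx Dy px py.
have pp : 0 < phi x - phi y by lra.
set t0 := - phi y / (phi x - phi y).
have t00 : 0 < t0 by apply: divr_gt0; lra.
have t01 : t0 <= 1 by rewrite ler_pdivrMr //; lra.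
suff : 0 <= t0 * f x + (1 - t0) * f y.
  have -> : t0 * f x + (1 - t0) * f y
          = (phi x * f y - phi y * f x) / (phi x - phi y).
    by rewrite /t0; field; rewrite gt_eqF.
  by rewrite pmulr_lge0 // invr_gt0.
apply: (@ge0_of_mix _ _ (f y)) => e /andP[e0 e1].
set t := (1 - e) * t0.
have ht : 0 <= t <= 1.
  by apply/andP; split; rewrite /t; nra.
have -> : (1 - e) * (t0 * f x + (1 - t0) * f y) + e * f y
        = t * f x + (1 - t) * f y by rewrite /t; ring.
apply: le_trans (cf x y t ht); apply: H; first exact: cD.
apply: le_lt_trans (cp x y t ht) _.
have E0 : t0 * phi x + (1 - t0) * phi y = 0.
  by rewrite /t0; field; rewrite gt_eqF.
have -> : t * phi x + (1 - t) * phi y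
   = (1 - e) * (t0 * phi x + (1 - t0) * phi y) + e * phi y by rewrite /t; ring.
by rewrite E0; nra.
Qed.

(* The multiplier is the supremum of 0 and of - f / phi over the points of D
   where phi > 0; it is at most f / (- phi) at every point where phi < 0. *)
Lemma slater_one (R : realType) (V : lmodType R) (D : set V) (f phi : V -> R)
    (x0 : V) :
  cvx_set D -> cvx_fun f -> cvx_fun phi -> D x0 -> phi x0 < 0 ->
  (forall z, D z -> phi z < 0 -> 0 <= f z) ->
  exists2 l, 0 <= l & forall z, D z -> 0 <= f z + l * phi z.
Proof.
move=> cD cf cp D0 p0 H.
set S : set R := [set l | l = 0 \/
  exists x, [/\ D x, 0 < phi x & l = - f x / phi x]].
have ubS y : D y -> phi y < 0 -> ubound S (f y / - phi y).
  move=> Dy py l [->|[x [Dx px ->]]].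
    by apply: divr_ge0; [exact: H|lra].
  have := slater_cross cD cf cp H Dx Dy (ltW px) py.
  rewrite ler_pdivrMr // mulrAC ler_pdivlMr; last by lra.
  by nra.
have S0 : S 0 by left.
have hS : has_ubound S by exists (f x0 / - phi x0); exact: ubS.
exists (sup S); first exact: ub_le_sup.
move=> z Dz; case: (ltrgtP (phi z) 0) => [pz|pz|pz].
- have : sup S <= f z / - phi z by apply: ge_sup; [exists 0|exact: ubS].
  by rewrite ler_pdivlMr; last lra; nra.
- have : - f z / phi z <= sup S.
    by apply: ub_le_sup => //; right; exists z.
  by rewrite ler_pdivrMr //; nra.
(* Where [phi z = 0] the multiplier term drops out, and [f z >= 0] comes from the comparison with
   the Slater point [x0]. *)
- have := slater_cross cD cf cp H Dz D0.
  rewrite pz lexx => /(_ isT p0).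
  by nra.
Qed.

Lemma cvx_funD (R : realType) (V : lmodType R) (f g : V -> R) (l : R) :
  0 <= l -> cvx_fun f -> cvx_fun g -> cvx_fun (fun z => f z + l * g z).
Proof.
move=> l0 cf cg x y t ht; have := cf x y t ht; have := cg x y t ht.
by move=> /(ler_wpM2l l0); lra.
Qed.

(* One constraint at a time: f + l * phi_a is again convex, and nonnegative
   wherever the remaining constraints hold. *)
Lemma slater_multipliers (R : realType) (V : lmodType R) (I : eqType)
    (r : seq I) (f : V -> R) (phi : I -> V -> R) (x0 : V) :
  uniq r -> cvx_fun f -> (forall i, cvx_fun (phi i)) ->
  (forall i, i \in r -> phi i x0 < 0) ->
  (forall z, (forall i, i \in r -> phi i z < 0) -> 0 <= f z) ->
  exists2 l : I -> R, forall i, 0 <= l i &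
    forall z, 0 <= f z + \sum_(i <- r) l i * phi i z.
Proof.
move=> + + cp; elim: r f => [|a r IH] f /=.
  move=> _ _ _ H; exists (fun=> 0) => // z; rewrite big_nil addr0; exact: H.
move=> /andP[ar ur] cf p0 H.
have [||||l l0 Hl] := @slater_one R V [set z | forall i, i \in r -> phi i z < 0]
  f (phi a) x0 _ cf (cp a).
- move=> x y t ht Dx Dy i ir; apply: le_lt_trans (cp i x y t ht) _.
  have := Dx _ ir; have := Dy _ ir; case/andP: ht => t0 t1 /=.
  have [->|tn] := eqVneq t 0; first by lra.
  by have {}tn : 0 < t by [rewrite lt_neqAle eq_sym tn]; nra.
- by move=> i ir /=; apply: p0; rewrite inE ir orbT.
- by apply: p0; rewrite inE eqxx.
- move=> z Dz pz; apply: H => i; rewrite inE => /orP[/eqP -> //|]; exact: Dz.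
have [||l' l'0 Hl'] := IH (fun z => f z + l * phi a z) ur (cvx_funD l0 cf (cp a)).
- by move=> i ir; apply: p0; rewrite inE ir orbT.
- by move=> z Dz; apply: Hl.
exists (fun i => if i == a then l else l' i) => [i|z]; first by case: ifP.
rewrite big_cons eqxx addrA.
rewrite (eq_big_seq (fun i => l' i * phi i z)) // => i ir.
by case: eqP => // ia; rewrite -ia ir in ar.
Qed.

(** * Geometry of the RKHS and duality for Omega *)

Section RkhsTheory.
Variables (R : realType) (d Q : nat) (X : set 'rV[R]_d).
Variables (K : 'rV[R]_d -> 'rV[R]_d -> 'M[R]_Q) (F : rkhs X K).
Implicit Types f g h : F.

Lemma rk_ipDl f g h : rk_ip (f + g) h = rk_ip f h + rk_ip g h.
Proof. by have := rk_ip_linear 1 f g h; rewrite scale1r mul1r. Qed.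

Lemma rk_ip0l h : rk_ip 0 h = 0.
Proof. by have := rk_ipDl 0 0 h; rewrite addr0; lra. Qed.

Lemma rk_ipZl a f h : rk_ip (a *: f) h = a * rk_ip f h.
Proof. by have := rk_ip_linear a f 0 h; rewrite addr0 rk_ip0l addr0. Qed.

Lemma rk_ipNl f h : rk_ip (- f) h = - rk_ip f h.
Proof. by rewrite -scaleN1r rk_ipZl mulN1r. Qed.

Lemma rk_ipBl f g h : rk_ip (f - g) h = rk_ip f h - rk_ip g h.
Proof. by rewrite rk_ipDl rk_ipNl. Qed.

Lemma rk_ip_suml (I : Type) (r : seq I) (P : pred I) (E : I -> F) h :
  rk_ip (\sum_(i <- r | P i) E i) h = \sum_(i <- r | P i) rk_ip (E i) h.
Proof.
elim/big_rec2: _ => [|i y1 y2 _ <-]; [exact: rk_ip0l|exact: rk_ipDl].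
Qed.

Lemma rk_ip0r h : rk_ip h 0 = 0.
Proof. by rewrite rk_ipC rk_ip0l. Qed.

Lemma rk_ipDr f g h : rk_ip h (f + g) = rk_ip h f + rk_ip h g.
Proof. by rewrite !(rk_ipC h) rk_ipDl. Qed.

Lemma rk_ipZr a f h : rk_ip h (a *: f) = a * rk_ip h f.
Proof. by rewrite !(rk_ipC h) rk_ipZl. Qed.

Lemma rk_ipBr f g h : rk_ip h (f - g) = rk_ip h f - rk_ip h g.
Proof. by rewrite !(rk_ipC h) rk_ipBl. Qed.

Lemma rk_ip_sumr (I : Type) (r : seq I) (P : pred I) (E : I -> F) h :
  rk_ip h (\sum_(i <- r | P i) E i) = \sum_(i <- r | P i) rk_ip h (E i).
Proof. by rewrite rk_ipC rk_ip_suml; apply: eq_bigr => i _; rewrite rk_ipC. Qed.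

Lemma rk_normsq f : `|f| ^+ 2 = rk_ip f f.
Proof. by rewrite rk_normE sqr_sqrtr // rk_ip_ge0. Qed.

Lemma rk_cauchy_schwarz f g : `|rk_ip f g| <= `|f| * `|g|.
Proof.
have [->|g0] := eqVneq g 0; first by rewrite rk_ip0r !normr0 mulr0.
have n0 : 0 < `|g| by rewrite normr_gt0.
have gg := rk_normsq g; have ff := rk_normsq f.
(* This square expands to [|g|^2 * (|f|^2 * |g|^2 - <f, g>^2)]. *)
have := rk_ip_ge0 (rk_ip g g *: f - rk_ip f g *: g).
rewrite rk_ipBl !rk_ipBr !rk_ipZl !rk_ipZr (rk_ipC g f) -gg -ff => H.
rewrite -(@ler_pXn2r _ 2) ?nnegrE ?mulr_ge0 // exprMn real_normK ?num_real //.
have g20 : 0 < `|g| ^+ 2 by rewrite exprn_gt0.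
rewrite -subr_ge0 -(@pmulr_rge0 _ (`|g| ^+ 2)) //.
by apply: le_trans H _; lra.
Qed.

Lemma rk_ip_ext f g : (forall h, rk_ip h f = rk_ip h g) -> f = g.
Proof.
move=> H; apply/eqP; rewrite -subr_eq0 -normr_eq0 -sqrf_eq0 rk_normsq.
by rewrite rk_ipBr H subrr.
Qed.

Lemma rk_ip_continuous h : continuous (rk_ip h).
Proof.
move=> f; apply/cvgrPdist_le => /= e e0.
have p0 : 0 < `|h| + 1 by rewrite ltr_wpDl.
near=> g.
rewrite -rk_ipBr; apply: le_trans (rk_cauchy_schwarz _ _) _.
have fg : `|f - g| <= e / (`|h| + 1).
  near: g; apply: cvgr_dist_le => //; exact: divr_gt0.
apply: (@le_trans _ _ ((`|h| + 1) * `|f - g|)).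
  by rewrite ler_wpM2r // lerDl.
by rewrite mulrC -ler_pdivlMr.
Unshelve. all: by end_near. Qed.

End RkhsTheory.

Section Duality.
Variables (R : realType) (d Q : nat) (X : set 'rV[R]_d).
Variables (K : 'rV[R]_d -> 'rV[R]_d -> 'M[R]_Q) (F : rkhs X K).
Variables (o : omega_data R F).

Lemma cvx_affine (h : F) (a : R) : cvx_fun (fun g : F => rk_ip h g + a).
Proof. by move=> x y t _; rewrite rk_ipDr !rk_ipZr; lra. Qed.

(** The convexity defect of the squared norm along a segment is exactly
    [t * (1 - t) * |x - y|^2]. *)
Lemma cvx_ball (c : F) (r : R) : cvx_fun (fun g : F => `|g - c| ^+ 2 - r ^+ 2).
Proof.
move=> x y t /andP[t0 t1].
have -> : t *: x + (1 - t) *: y - c = t *: (x - c) + (1 - t) *: (y - c).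
  rewrite !scalerBr addrACA -opprD -scalerDl.
  by rewrite (_ : t + (1 - t) = 1) ?scale1r //; lra.
move: (x - c) (y - c) => u v.
have := sqr_ge0 `|u - v|; rewrite !rk_normsq rk_ipBl !rk_ipBr.
rewrite rk_ipDl !rk_ipDr !rk_ipZl !rk_ipZr (rk_ipC v u) => H.
have : 0 <= t * (1 - t) by rewrite mulr_ge0 //; lra.
by move=> /mulr_ge0 => /(_ _ H); lra.
Qed.

(** All inequalities defining Omega are strict, so any of its points is a Slater point. Balls and
    half-spaces form one family of convex constraints, indexed by a disjoint sum. *)
Lemma omega_multipliers (h : F) (gam : R) :
  (forall j, 0 < om_r o j) -> omega_set o !=set0 ->
  (forall g, omega_set o g -> 0 <= rk_ip h g + gam) ->
  exists (l : 'I_(om_nB o) -> R) (xi : 'I_(om_nH o) -> R),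
  [/\ forall j, 0 <= l j, forall j, 0 <= xi j &
   forall g, 0 <= rk_ip h g + gam
     + \sum_j l j * (`|g - om_c o j| ^+ 2 - om_r o j ^+ 2)
     + \sum_j xi j * (rk_ip (om_v o j) g - om_rho o j)].
Proof.
move=> r0 [x0 [xB xH]] H.
pose phi (i : 'I_(om_nB o) + 'I_(om_nH o)) (g : F) : R :=
  match i with
  | inl j => `|g - om_c o j| ^+ 2 - om_r o j ^+ 2
  | inr j => rk_ip (om_v o j) g - om_rho o j
  end.
have phiB g j : (phi (inl j) g < 0) = (`|g - om_c o j| < om_r o j).
  by rewrite /phi subr_lt0 ltr_pXn2r // nnegrE // ltW.
have phiH g j : (phi (inr j) g < 0) = (rk_ip (om_v o j) g < om_rho o j).
  by rewrite /phi subr_lt0.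
have [||||l l0 Hl] := @slater_multipliers R F _
  (index_enum ('I_(om_nB o) + 'I_(om_nH o))%type)
  (fun g => rk_ip h g + gam) phi x0 (index_enum_uniq _).
- exact: cvx_affine.
- by case=> j; [exact: cvx_ball|exact: cvx_affine].
- by case=> j _; rewrite ?phiB ?phiH.
- move=> z Hz; apply: H; split=> j.
    by rewrite -phiB; apply: Hz; rewrite mem_index_enum.
  by rewrite -phiH; apply: Hz; rewrite mem_index_enum.
exists (l \o inl), (l \o inr); split=> [j|j|g]; [exact: l0|exact: l0|].
by have := Hl g; rewrite big_sumType /= addrA.
Qed.

(* The balls are written as quadratic constraints, with multipliers l_j.  If
   they do not all vanish, the Lagrangian is minimal at an explicit gs in the
   span, and g_j = 2 l_j (c_j - gs); AM-GM turns |c_j - gs|^2 + r_j^2 into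
   2 r_j |c_j - gs|. *)
Lemma omega_dual (h : F) (gam : R) :
  (forall j, 0 < om_r o j) -> omega_set o !=set0 ->
  (forall g, omega_set o g -> 0 <= rk_ip h g + gam) ->
  exists (g : 'I_(om_nB o) -> F) (xi : 'I_(om_nH o) -> R),
    [/\ forall j, omega_span o h (g j),
        forall j, 0 <= xi j,
        0 <= gam + \sum_j rk_ip (g j) (om_c o j)
             - \sum_j xi j * om_rho o j
             - \sum_j om_r o j * `|g j| &
        - h + \sum_j g j - \sum_j xi j *: om_v o j = 0].
Proof.
move=> r0 ne H; have [l [xi [l0 xi0 Hl]]] := omega_multipliers r0 ne H.
pose L := \sum_j l j; pose w := h + \sum_j xi j *: om_v o j.
have L0 : 0 <= L by exact: sumr_ge0.
have [LE|Ln] := eqVneq L 0.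
  have lE j : l j = 0.
    apply/eqP; move/eqP: LE; rewrite psumr_eq0 // => /allP /(_ j).
    by rewrite mem_index_enum; apply.
  have Hw g : 0 <= rk_ip w g + (gam - \sum_j xi j * om_rho o j).
    have := Hl g; rewrite big1 => [|j _]; last by rewrite lE mul0r.
    rewrite addr0 /w rk_ipDl rk_ip_suml.
    under eq_bigr do rewrite mulrBr -rk_ipZl.
    by rewrite sumrB; lra.
  have w0 : w = 0.
    apply/eqP; rewrite -normr_eq0 -sqrf_eq0 rk_normsq; apply/negPn/negP => wn.
    have wp : 0 < rk_ip w w by rewrite lt_neqAle eq_sym wn rk_ip_ge0.
    (* At this multiple of [w] the affine function of [Hw] equals -1. *)
    have := Hw ((- ((gam - \sum_j xi j * om_rho o j) + 1) / rk_ip w w) *: w).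
    by rewrite rk_ipZr mulfVK //; lra.
  exists (fun=> 0), xi; split => //.
  - move=> j; exists 0, (fun=> 0), (fun=> 0).
    by rewrite scale0r !big1 ?addr0 // => i _; rewrite scale0r.
  - rewrite big1 => [|j _]; last by rewrite rk_ip0l.
    rewrite [X in _ - X]big1 => [|j _]; last by rewrite normr0 mulr0.
    by have := Hw 0; rewrite rk_ip0r; lra.
  - by rewrite big1 // addr0 -opprD -/w w0 oppr0.
have Lp : 0 < L by rewrite lt_neqAle eq_sym Ln.
pose gs := (2 * L)^-1 *: ((\sum_j (2 * l j) *: om_c o j) - w).
(* Stationarity: the gradient of the Lagrangian at [g] is [w + 2 * L * g] minus the sum of the
   [2 * l j * c_j], and [gs] is its zero. *)
have wE : w = \sum_j (2 * l j) *: (om_c o j - gs).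
  under eq_bigr do rewrite scalerBr.
  rewrite sumrB -scaler_suml -mulr_sumr -/L /gs scalerA divff; last first.
    by rewrite mulf_neq0 // pnatr_eq0.
  by rewrite scale1r opprB addrC subrK.
exists (fun j => (2 * l j) *: (om_c o j - gs)), xi; split => //.
- move=> j.
  (* The coefficients are read off from [2 * l j * (c_j - gs)] after unfolding [gs] and [w]. *)
  exists ((2 * l j) * (2 * L)^-1),
   (fun i => (2 * l j) * ((i == j)%:R - (2 * L)^-1 * (2 * l i))),
   (fun i => (2 * l j) * ((2 * L)^-1 * xi i)).
  have E1 : \sum_i (2 * l j * ((i == j)%:R - (2 * L)^-1 * (2 * l i))) *: om_c o i
    = (2 * l j) *: (om_c o j - (2 * L)^-1 *: \sum_i (2 * l i) *: om_c o i).
    under eq_bigr do rewrite -scalerA scalerBl -[((2 * L)^-1 * _) *: _]scalerA.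
    rewrite -scaler_sumr sumrB -[in X in _ - X]scaler_sumr; congr (_ *: (_ - _)).
    rewrite (bigD1 j) //= eqxx scale1r big1 ?addr0 // => i /negPf ->.
    by rewrite scale0r.
  have E2 : \sum_i (2 * l j * ((2 * L)^-1 * xi i)) *: om_v o i
    = (2 * l j) *: ((2 * L)^-1 *: \sum_i xi i *: om_v o i).
    by rewrite 2!scaler_sumr; apply: eq_bigr => i _; rewrite !scalerA mulrA.
  rewrite E1 E2 -[_ *: h]scalerA -!scalerDr /gs /w; congr (_ *: _).
  by rewrite scalerBr opprB scalerDr [RHS]addrAC [RHS]addrA [LHS]addrC [LHS]addrAC.
- have := Hl gs.
  have -> : rk_ip h gs = \sum_j (2 * l j) * rk_ip (om_c o j - gs) gs
      - \sum_j xi j * rk_ip (om_v o j) gs.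
    have -> : h = w - \sum_j xi j *: om_v o j by rewrite /w addrK.
    rewrite rk_ipBl {1}wE !rk_ip_suml.
    under eq_bigr do rewrite rk_ipZl.
    by under [X in _ - X]eq_bigr do rewrite rk_ipZl.
  under [X in _ <= _ + _ + X]eq_bigr do rewrite mulrBr.
  rewrite sumrB => H1.
  suff : \sum_j (2 * l j * rk_ip (om_c o j - gs) gs) +
     \sum_j l j * (`|gs - om_c o j| ^+ 2 - om_r o j ^+ 2) <=
     \sum_j rk_ip ((2 * l j) *: (om_c o j - gs)) (om_c o j)
     - \sum_j om_r o j * `|(2 * l j) *: (om_c o j - gs)| by lra.
  rewrite -big_split -sumrB; apply: ler_sum => j _ /=.
  rewrite normrZ ger0_norm ?mulr_ge0 // rk_ipZl distrC.
  have -> : rk_ip (om_c o j - gs) (om_c o j)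
      = rk_ip (om_c o j - gs) gs + `|om_c o j - gs| ^+ 2.
    by rewrite rk_normsq -rk_ipDr [gs + _]addrC subrK.
  have := sqr_ge0 (`|om_c o j - gs| - om_r o j).
  by have := l0 j => /mulr_ge0 => /[apply]; lra.
- by rewrite -wE addrAC -opprD -/w addNr.
Qed.

End Duality.

(** * Finite differences and iterated partial derivatives *)

Section FiniteDifferences.
Variables (R : realType) (d : nat).
Local Notation E := 'rV[R]_d.
Local Notation e_ i := (delta_mx 0 i : 'rV[R]_d).

(* Each direction of the word has its own step. *)
Fixpoint fd (V : lmodType R) (l : seq 'I_d) (hs : seq R) (g : E -> V) (x : E)
    : V :=
  match l, hs with
  | i :: l', h :: hs' =>
      h^-1 *: (fd l' hs' g (x + h *: e_ i) - fd l' hs' g x)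
  | _, _ => g x
  end.

(** A bound on how far from [x] the points used by [fd l hs g x] lie, since each [e_ i] has norm at
    most 1. *)
Definition reach (hs : seq R) : R := \sum_(h <- hs) `|h|.

Lemma reach_ge0 hs : 0 <= reach hs.
Proof. exact: sumr_ge0. Qed.

Lemma reach_cons h hs : reach (h :: hs) = `|h| + reach hs.
Proof. exact: big_cons. Qed.

Lemma norm_e_le (i : 'I_d) : `|e_ i| <= 1.
Proof.
rewrite /Num.norm /= mx_normrE; apply: bigmax_le => // ab _.
by rewrite mxE; case: (_ && _); rewrite ?normr1 ?normr0.
Qed.

Lemma dist_step (i : 'I_d) (y x : E) (h r : R) :
  `|y - x| <= r -> `|y + h *: e_ i - x| <= `|h| + r.
Proof.
move=> H; rewrite addrAC addrC; apply: le_trans (ler_normD _ _) _.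
apply: lerD => //; rewrite normrZ -[leRHS]mulr1.
by rewrite ler_wpM2l // norm_e_le.
Qed.

Lemma fd_map (V W : lmodType R) (T : V -> W) l hs (g : E -> V) x :
  (forall a u v, T (a *: (u - v)) = a *: (T u - T v)) ->
  T (fd l hs g x) = fd l hs (T \o g) x.
Proof.
move=> HT; elim: l hs x => [|i l IH] [|h hs] x //=.
by rewrite HT !IH.
Qed.

Lemma fd_eq (V : lmodType R) l hs (g1 g2 : E -> V) x :
  (forall y, `|y - x| <= reach hs -> g1 y = g2 y) ->
  fd l hs g1 x = fd l hs g2 x.
Proof.
move=> H; have : `|x - x| <= 0 by rewrite subrr normr0.
(* The evaluation point moves during the induction, so it becomes a point [z] within a slack [r] of
   the fixed centre [x]. *)
rewrite -[reach hs]addr0 in H; move: H; move: 0 {2 4 5}x => r.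
elim: l hs r => [|i l IH] [|h hs] r z /= H Hz.
- by apply: H; rewrite /reach big_nil add0r.
- by apply: H; apply: le_trans Hz _; rewrite lerDr reach_ge0.
- by apply: H; rewrite /reach big_nil add0r.
rewrite (IH _ (`|h| + r)) ?(IH _ r) ?dist_step // => y Hy; apply: H;
  apply: le_trans Hy _; rewrite reach_cons; have := normr_ge0 h; lra.
Qed.

Lemma fd_lin (V : lmodType R) l hs (a : R) (g1 g2 : E -> V) x :
  fd l hs (fun z => a *: (g1 z - g2 z)) x = a *: (fd l hs g1 x - fd l hs g2 x).
Proof.
elim: l hs x => [|i l IH] [|h hs] x //=.
rewrite !IH -[in LHS]scalerBr -[in RHS]scalerBr !scalerA [h^-1 * a]mulrC.
by congr (_ *: _); rewrite !opprD !opprK addrACA.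
Qed.

Lemma fd_shift (V : lmodType R) l hs (g : E -> V) v x :
  fd l hs (fun z => g (z + v)) x = fd l hs g (x + v).
Proof.
by elim: l hs x => [|i l IH] [|h hs] x //=; rewrite !IH addrAC.
Qed.

(** Differencing is linear and commutes with translations, so the outermost difference may be
    applied to [g] first. This drives the induction of [fd_mvt]. *)
Lemma fd_cons (V : lmodType R) i l h hs (g : E -> V) x :
  fd (i :: l) (h :: hs) g x =
  fd l hs (fun z => h^-1 *: (g (z + h *: e_ i) - g z)) x.
Proof. by rewrite fd_lin fd_shift. Qed.

Lemma fd_fubini (V : lmodType R) l l' hs hs' (w : E -> E -> V) x x' :
  fd l hs (fun y => fd l' hs' (w y) x') x =
  fd l' hs' (fun z => fd l hs (w^~ z) x) x'.
Proof.
elim: l hs x => [|i l IH] [|h hs] x //=.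
by rewrite !IH -fd_lin.
Qed.


Lemma ex_iter_pderiv_sub (U U' : set E) l (g : E -> R) :
  U' `<=` U -> ex_iter_pderiv U l g -> ex_iter_pderiv U' l g.
Proof.
move=> UU; elim: l => [//|i l IH] /= [/IH ? H]; split=> // x /UU; exact: H.
Qed.

Lemma iter_pderiv_eq (U : set E) l (g1 g2 : E -> R) : open U ->
  (forall x, U x -> g1 x = g2 x) ->
  forall x, U x -> iter_pderiv l g1 x = iter_pderiv l g2 x.
Proof.
move=> oU H; elim: l => [|i l IH] x Ux; first exact: H.
apply: near_eq_derive; near=> y; apply: IH; near: y; exact: open_nbhs_nbhs.
Unshelve. all: by end_near. Qed.

Lemma iter_pderiv_lin (U : set E) l (a : R) (g1 g2 : E -> R) : open U ->
  ex_iter_pderiv U l g1 -> ex_iter_pderiv U l g2 ->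
  ex_iter_pderiv U l (fun z => a *: (g1 z - g2 z)) /\
  forall x, U x -> iter_pderiv l (fun z => a *: (g1 z - g2 z)) x
                   = a *: (iter_pderiv l g1 x - iter_pderiv l g2 x).
Proof.
move=> oU; elim: l => [//|i l IH] /= [e1 D1] [e2 D2].
have [e12 E12] := IH e1 e2.
have H x : U x -> is_derive x (e_ i) (iter_pderiv l (fun z => a *: (g1 z - g2 z)))
  (a *: (pderiv i (iter_pderiv l g1) x - pderiv i (iter_pderiv l g2) x)).
  move=> Ux; apply: (@near_eq_is_derive _ _ _
    (a \*: (iter_pderiv l g1 - iter_pderiv l g2))).
    by near=> y; rewrite E12 //; near: y; exact: open_nbhs_nbhs.
  have /derivableP d1 := D1 x Ux; have /derivableP d2 := D2 x Ux.
  exact: is_deriveZ.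
split.
  split; first exact: e12.
  by move=> x /H Hx; exact: (@ex_derive _ _ _ _ _ _ _ Hx).
by move=> x /H Hx; exact: (@derive_val _ _ _ _ _ _ _ Hx).
Unshelve. all: by end_near. Qed.

Lemma derive_shift (g : E -> R) (v w z : E) :
  ('D_w (fun y => g (y + v)) z = 'D_w g (z + v)) /\
  (derivable g (z + v) w -> derivable (fun y => g (y + v)) z w).
Proof.
rewrite /derive /derivable.
have -> : (fun h : R =>
    h^-1 *: (((fun y => g (y + v)) \o shift z) (h *: w) - g (z + v)))
  = (fun h => h^-1 *: ((g \o shift (z + v)) (h *: w) - g (z + v))).
  by apply/funext => h /=; rewrite addrA.
by [].
Qed.

Lemma iter_pderiv_shift l (g : E -> R) v z :
  iter_pderiv l (fun y => g (y + v)) z = iter_pderiv l g (z + v).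
Proof.
elim: l z => [|i l IH] z; first by [].
have E1 : iter_pderiv l (fun y => g (y + v)) = fun y => iter_pderiv l g (y + v).
  by apply/funext => y; exact: IH.
rewrite [LHS]/= E1.
exact: (derive_shift (iter_pderiv l g) v (e_ i) z).1.
Qed.

Lemma ex_iter_pderiv_shift (U : set E) l (g : E -> R) v :
  ex_iter_pderiv U l g ->
  ex_iter_pderiv [set z | U (z + v)] l (fun y => g (y + v)).
Proof.
elim: l => [|i l IH]; first by [].
case=> /IH e1 D; split; first exact: e1.
move=> x /D Dx.
have -> : iter_pderiv l (fun y => g (y + v)) = fun y => iter_pderiv l g (y + v).
  by apply/funext => y; rewrite iter_pderiv_shift.
exact: (derive_shift (iter_pderiv l g) v (e_ i) x).2 Dx.
Qed.

Lemma is_derive_line (g : E -> R) x v (t : R) :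
  derivable g (x + t *: v) v ->
  is_derive t 1 (fun t => g (x + t *: v)) ('D_v g (x + t *: v)).
Proof.
have EQ : (fun h : R =>
    h^-1 *: ((g \o shift (x + t *: v)) (h *: v) - g (x + t *: v)))
  = (fun h : R =>
    h^-1 *: (((fun t => g (x + t *: v)) \o shift t) (h *: (1 : R)) - g (x + t *: v))).
  apply/funext => h /=; congr (_ *: (g _ - _)).
  by rewrite addrCA -scalerDl /GRing.scale /= mulr1.
by rewrite /derivable /derive EQ => H; split.
Qed.

Lemma pderiv_mvt (g : E -> R) i x (h : R) :
  (forall t, `|t| <= `|h| -> derivable g (x + t *: e_ i) (e_ i)) ->
  exists2 t, `|t| <= `|h| &
    g (x + h *: e_ i) - g x = h * pderiv i g (x + t *: e_ i).
Proof.
move=> D; set psi := fun t : R => g (x + t *: e_ i).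
have dpsi (t : R) : `|t| <= `|h| -> is_derive t 1 psi (pderiv i g (x + t *: e_ i)).
  by move=> /D; exact: is_derive_line.
have cpsi (a b : R) : (forall t, t \in `[a, b] -> `|t| <= `|h|) ->
    {within `[a, b], continuous psi}.
  move=> H; apply: derivable_within_continuous => t /H /dpsi []; done.
have psi0 : psi 0 = g x by rewrite /psi scale0r addr0.
rewrite -psi0 -/(psi h); case: (leP 0 h) => h0.
- have ab t : t \in `[0, h] -> `|t| <= `|h|.
    by rewrite in_itv /= => /andP[t0 t1]; rewrite !ger0_norm.
  have [t ht ->] := @MVT_segment R psi (fun t => pderiv i g (x + t *: e_ i)) 0 h
    h0 (fun t ht => dpsi t (ab t (subset_itv_oo_cc ht))) (cpsi _ _ ab).
  by exists t; [exact: ab|rewrite subr0 mulrC].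
- have ab t : t \in `[h, 0] -> `|t| <= `|h|.
    by rewrite in_itv /= => /andP[t0 t1]; rewrite !ler0_norm ?lerN2 // ltW.
  have [t ht E1] := @MVT_segment R psi (fun t => pderiv i g (x + t *: e_ i)) h 0
    (ltW h0) (fun t ht => dpsi t (ab t (subset_itv_oo_cc ht))) (cpsi _ _ ab).
  by exists t; [exact: ab|rewrite -opprB E1 sub0r mulrN opprK mulrC].
Qed.

Lemma open_shift (U : set E) v : open U -> open [set z | U (z + v)].
Proof.
rewrite !openE => oU z /oU Uz.
have cv : (fun y : E => y + v) @ z --> z + v.
  exact: (cvgD cvg_id (cvg_cst _)).
have := cv U Uz; rewrite /interior /=; apply.
Qed.

Definition steps (l : seq 'I_d) (hs : seq R) : Prop :=
  size hs = size l /\ all (fun h => h != 0) hs.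

(** The induction hypothesis is applied to the difference quotient of [g] in the first direction,
    which is smooth where both [z] and [z + v] lie in [U]. It produces the quotient of
    [iter_pderiv l g] at some point, and the one-dimensional mean value theorem turns that quotient
    into the last derivative. *)
Lemma fd_mvt (U : set E) l hs (g : E -> R) (x : E) :
  open U -> steps l hs -> (forall y : E, `|y - x| <= reach hs -> U y) ->
  ex_iter_pderiv U l g ->
  exists2 xi : E, `|xi - x| <= reach hs & fd l hs g x = iter_pderiv l g xi.
Proof.
elim: l hs U g => [|i l IH] hs U g oU [].
  by move=> _ _ _ _; exists x; [rewrite subrr normr0 reach_ge0|case: hs].
case: hs => [//|h hs] /= /eq_add_S sz /andP[h0 nz] HU [eg Dg].
set v := h *: e_ i.
have oU' : open [set z | U (z + v)] by exact: open_shift.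
have oUU' : open (U `&` [set z | U (z + v)]) by exact: openI.
have [e1 E1] := iter_pderiv_lin h^-1 oUU'
  (ex_iter_pderiv_sub (@subIsetr _ _ _) (ex_iter_pderiv_shift v eg))
  (ex_iter_pderiv_sub (@subIsetl _ _ _) eg).
have HU' (y : E) : `|y - x| <= reach hs -> (U `&` [set z | U (z + v)]) y.
  move=> Hy; split; apply: HU; rewrite reach_cons; last exact: dist_step.
  by apply: le_trans Hy _; rewrite lerDr.
have [xi Hxi E2] := IH hs _ _ oUU' (conj sz nz : steps l hs) HU' e1.
have [|t ht E3] := @pderiv_mvt (iter_pderiv l g) i xi h.
  move=> t ht; apply: Dg; apply: HU; rewrite reach_cons.
  by apply: le_trans (dist_step _ _ Hxi) _; rewrite lerD2r.
exists (xi + t *: e_ i).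
  by rewrite reach_cons; apply: le_trans (dist_step _ _ Hxi) _; rewrite lerD2r.
transitivity (fd (i :: l) (h :: hs) g x); first by [].
rewrite fd_cons E2 E1 ?iter_pderiv_shift ?E3; last exact: HU'.
by rewrite /GRing.scale /= mulKf.
Qed.

(** A difference in the first variable is a finite linear combination of slices of [w], so it
    commutes with derivatives in the second variable. *)
Lemma iter_pderiv_fd (U : set E) l l1 hs (w : E -> E -> R) (x : E) :
  open U -> (forall y : E, `|y - x| <= reach hs -> U y) ->
  (forall y, U y -> ex_iter_pderiv U l (w y)) ->
  ex_iter_pderiv U l (fun z => fd l1 hs (w^~ z) x) /\
  forall z, U z -> iter_pderiv l (fun z => fd l1 hs (w^~ z) x) z
                   = fd l1 hs (fun y => iter_pderiv l (w y) z) x.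
Proof.
move=> oU + He; elim: l1 hs x => [|i l1 IH] [|h hs] x HU //=;
  try by split => //; apply: He; apply: HU; rewrite subrr normr0 reach_ge0.
rewrite reach_cons in HU.
have HU1 y : `|y - (x + h *: e_ i)| <= reach hs -> U y.
  move=> Hy; apply: HU.
  have -> : y - x = y - (x + h *: e_ i) + h *: e_ i by rewrite opprD addrA subrK.
  rewrite -[_ + _ *: _]subr0; apply: dist_step; by rewrite subr0.
have HU2 y : `|y - x| <= reach hs -> U y.
  by move=> Hy; apply: HU; apply: le_trans Hy _; rewrite lerDr.
have [e1 E1] := IH hs _ HU1; have [e2 E2] := IH hs _ HU2.
have [e3 E3] := iter_pderiv_lin h^-1 oU e1 e2.
by split => // z Uz; rewrite E3 // E1 // E2.
Qed.

(* The differences in z are evaluated first, so only derivatives of w taken in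
   the order prescribed by [mpderiv2] occur: no interchange of derivatives. *)
Lemma fd_gram_mvt (U : set E) l hs hs' (w : E -> E -> R) (x : E) :
  open U -> steps l hs -> steps l hs' ->
  (forall y : E, `|y - x| <= reach hs -> U y) ->
  (forall y : E, `|y - x| <= reach hs' -> U y) ->
  (forall y, U y -> ex_iter_pderiv U l (w y)) ->
  (forall z, U z -> ex_iter_pderiv U l (fun y => iter_pderiv l (w y) z)) ->
  exists xi xi' : E, [/\ `|xi - x| <= reach hs, `|xi' - x| <= reach hs' &
    fd l hs (fun y => fd l hs' (w y) x) x
      = iter_pderiv l (fun y => iter_pderiv l (w y) xi') xi].
Proof.
move=> oU s1 s2 H1 H2 e1 e2.
have [e3 E3] := iter_pderiv_fd l oU H1 e1.
have [xi' Hxi' E4] := fd_mvt oU s2 H2 e3.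
have [xi Hxi E5] := fd_mvt oU s1 H1 (e2 _ (H2 _ Hxi')).
exists xi, xi'; split => //.
by rewrite fd_fubini E4 E3 ?E5 //; exact: H2.
Qed.

End FiniteDifferences.

(** * Limits of finite differences and their relation to iterated derivatives *)

Section DifferenceLimits.
Variables (R : realType) (d : nat).
Local Notation E := 'rV[R]_d.
Local Notation e_ i := (delta_mx 0 i : 'rV[R]_d).

(* Joint limit of the finite differences as all the steps tend to 0. *)
Definition fd_cvg (V : normedModType R) (l : seq 'I_d) (g : E -> V) (x : E)
    (v : V) : Prop :=
  forall e : R, 0 < e -> exists2 dl : R, 0 < dl &
    forall hs, steps l hs -> reach hs <= dl -> `|fd l hs g x - v| <= e.

(** Dividing by the length plus one keeps the reach at most [t] and the denominator positive, even
    for the empty word. *)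
Definition even_steps (l : seq 'I_d) (t : R) : seq R :=
  nseq (size l) ((size l).+1%:R^-1 * t).

Lemma steps_even l (t : R) : 0 < t -> steps l (even_steps l t).
Proof.
move=> t0; split; first by rewrite size_nseq.
by rewrite all_nseq lt0r_neq0 ?orbT // mulr_gt0 ?invr_gt0 ?ltr0n.
Qed.

Lemma reach_even l (t : R) : 0 < t -> reach (even_steps l t) <= t.
Proof.
move=> t0; rewrite /reach /even_steps big_nseq iter_addr_0.
rewrite ger0_norm; last by rewrite mulr_ge0 ?invr_ge0 ?ltW.
rewrite -[leRHS]mul1r -mulrnAl ler_wpM2r ?(ltW t0) //.
by rewrite -[leLHS]mulr_natl ler_pdivrMr ?ltr0n // mul1r ler_nat.
Qed.

Lemma fd_cvg_small (V : normedModType R) l (g : E -> V) x v (e dl : R) :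
  fd_cvg l g x v -> 0 < e -> 0 < dl ->
  exists2 dl' : R, 0 < dl' <= dl &
    forall t, 0 < t <= dl' -> `|fd l (even_steps l t) g x - v| <= e.
Proof.
move=> H /H[d1 d10 Hd] d0; exists (Num.min d1 dl).
  by rewrite lt_min d10 d0 ge_min lexx orbT.
move=> t /andP[t0]; rewrite le_min => /andP[td1 _]; apply: Hd.
  exact: steps_even.
exact: le_trans (reach_even _ t0) td1.
Qed.

(** The sequence with even steps of reach at most [1 / (n + 1)] is Cauchy and supplies the limit;
    the Cauchy condition then compares arbitrary steps with a far term of it. *)
Lemma fd_cvg_complete (V : completeNormedModType R) l (g : E -> V) x :
  (forall e : R, 0 < e -> exists2 dl : R, 0 < dl &
    forall hs hs', steps l hs -> steps l hs' -> reach hs <= dl ->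
      reach hs' <= dl -> `|fd l hs g x - fd l hs' g x| <= e) ->
  exists v, fd_cvg l g x v.
Proof.
move=> C; pose u (n : nat) := fd l (even_steps l (n.+1%:R^-1 : R)) g x.
have n0 (n : nat) : 0 < (n.+1%:R^-1 : R) by rewrite invr_gt0 ltr0n.
have small (dl : R) : 0 < dl -> \forall n \near \oo, (n.+1%:R^-1 : R) <= dl.
  move=> dl0; have := @near_infty_natSinv_lt R (PosNum dl0).
  by apply: filterS => n /ltW.
have cu : cvg (u @ \oo).
  apply: cauchy_cvg; apply: cauchy_exP => e e0.
  have e20 : 0 < e / 2 by lra.
  have [dl dl0 Hdl] := C _ e20.
  have [N _ HN] := small _ dl0; exists (u N), N => // n /= Nn.
  rewrite -ball_normE /=; apply: (@le_lt_trans _ _ (e / 2)); last by lra.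
  apply: Hdl; [exact: steps_even|exact: steps_even| |].
    by apply: le_trans (reach_even _ _) (HN _ _) => /=.
  by apply: le_trans (reach_even _ _) (HN _ _) => /=.
exists (lim (u @ \oo)) => e e0.
have e20 : 0 < e / 2 by lra.
have [dl dl0 Hdl] := C _ e20; exists dl => // hs Hs Hr.
have /cvgrPdist_le /(_ _ e20) cl : u @ \oo --> lim (u @ \oo) by exact: cu.
near \oo => n; have -> : e = e / 2 + e / 2 by lra.
apply: le_trans (ler_distD (u n) _ _) _; apply: lerD.
  apply: Hdl => //; first exact: steps_even.
  by apply: le_trans (reach_even _ _) _ => //; near: n; exact: small.
by rewrite distrC; near: n.
Unshelve. all: by end_near. Qed.

(* In the joint limit all steps but the outermost may tend to 0 first. *)
Lemma fd_cvg_iter_pderiv (U : set E) l (f : E -> R) : open U ->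
  (forall k x, U x -> exists v : R, fd_cvg (drop k l) f x v) ->
  ex_iter_pderiv U l f /\
  forall x (v : R), U x -> fd_cvg l f x v -> iter_pderiv l f x = v.
Proof.
move=> oU; elim: l => [|i l IH] H.
  split=> // x v _ fv; apply/eqP; rewrite -subr_eq0 -normr_eq0 eq_le normr_ge0 andbT.
  apply/ler_addgt0Pl => e e0; rewrite addr0.
  have [dl dl0 /(_ [::])] := fv e e0; apply => //.
  by rewrite /reach big_nil ltW.
have [e1 E1] := IH (fun k => H k.+1).
have D x (v : R) : U x -> fd_cvg (i :: l) f x v ->
    is_derive x (e_ i) (iter_pderiv l f) v.
  move=> Ux fv.
  suff cv : (fun h : R => h^-1 *: ((iter_pderiv l f \o shift x) (h *: e_ i)
              - iter_pderiv l f x)) @ 0^' --> v.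
    split; first by apply/cvg_ex; exists v.
    exact: cvg_lim cv.
  apply/cvgrPdist_le => /= e e0.
  have e20 : 0 < e / 2 by lra.
  have [dl dl0 Hdl] := fv _ e20.
  have dl20 : 0 < dl / 2 by lra.
  have [v0 fv0] := H 1 x Ux; rewrite /= drop0 in fv0.
  have Uxh : \forall h \near (0 : R), U (x + h *: e_ i).
    have cx : (fun h : R => x + h *: e_ i) @ (0 : R) --> x + (0 : R) *: e_ i.
      by apply: cvgD; [exact: cvg_cst|apply: cvgZl; exact: cvg_id].
    have := cx U; rewrite scale0r addr0; apply.
    exact: open_nbhs_nbhs.
  near=> h.
  have h0 : h != 0 by near: h; exact: nbhs_dnbhs_neq.
  have hd : `|h| <= dl / 2 by near: h; apply: dnbhs0_le.
  have Uh : U (x + h *: e_ i) by near: h; exact: nbhs_dnbhs.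
  have [v1 fv1] := H 1 _ Uh; rewrite /= drop0 in fv1.
  (* The errors at [x] and at [x + h *: e_ i] get divided by [h], hence this tolerance. Taking
     [d1 <= d0 <= dl / 2] lets both points share one step size and keeps the total reach below
     [dl]. *)
  have c0 : 0 < e / 4 * `|h| by rewrite mulr_gt0 ?normr_gt0 //; lra.
  have [d0 /andP[d00 d0d] Hd0] := fd_cvg_small fv0 c0 dl20.
  have [d1 /andP[d10 d1d] Hd1] := fd_cvg_small fv1 c0 d00.
  have {}Hd0 := Hd0 d1; have {}Hd1 := Hd1 d1.
  rewrite d10 d1d lexx in Hd0 Hd1; have {}Hd0 := Hd0 isT; have {}Hd1 := Hd1 isT.
  rewrite /= [h *: _ + x]addrC (E1 _ _ Ux fv0) (E1 _ _ Uh fv1).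
  have [sz nz] := @steps_even l d1 d10.
  have := Hdl (h :: even_steps l d1); rewrite /steps /= sz nz h0 reach_cons.
  have Hr : `|h| + reach (even_steps l d1) <= dl.
    have := @reach_even l d1 d10; lra.
  move=> /(_ (conj erefl isT) Hr).
  set A := fd l _ f (_ + _) in Hd1 *; set A0 := fd l _ f x in Hd0 *.
  rewrite /GRing.scale /= => HA.
  have -> : v - h^-1 * (v1 - v0)
    = - (h^-1 * (A - A0) - v) + h^-1 * (A - v1) - h^-1 * (A0 - v0) by ring.
  have hn : 0 < `|h| by rewrite normr_gt0.
  have B (z : R) : `|z| <= e / 4 * `|h| -> `|h^-1 * z| <= e / 4.
    by move=> Hz; rewrite normrM normfV mulrC ler_pdivrMr.
  apply: le_trans (ler_normB _ _) _.
  have := ler_normD (- (h^-1 * (A - A0) - v)) (h^-1 * (A - v1)).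
  by have := B _ Hd0; have := B _ Hd1; rewrite normrN; lra.
split.
  split; first exact: e1.
  move=> x Ux; have [v fv] := H 0 x Ux; rewrite drop0 in fv.
  by have [] := D x v Ux fv.
by move=> x v Ux fv; have Dx := D x v Ux fv; exact: (@derive_val _ _ _ _ _ _ _ Dx).
Unshelve. all: by end_near. Qed.

End DifferenceLimits.

(** * Reproducing property of derivatives *)

Section ReproducingDerivatives.
Variables (R : realType) (d Q : nat) (X : set 'rV[R]_d).
Variables (K : 'rV[R]_d -> 'rV[R]_d -> 'M[R]_Q) (F : rkhs X K).
Local Notation E := 'rV[R]_d.
Local Notation U := (interior X).

Lemma within_continuous2_dist (G : E * E -> R) (x : E) (e : R) :
  {within X `*` X, continuous G} -> X x -> 0 < e ->
  exists2 dl : R, 0 < dl & forall a b : E, X a -> X b ->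
    `|a - x| <= dl -> `|b - x| <= dl -> `|G (a, b) - G (x, x)| <= e.
Proof.
move=> /subspace_continuousP cG Xx e0.
have /cvgrPdist_le /(_ e e0) := cG (x, x) (conj Xx Xx).
rewrite /= near_withinE => /nbhs_ballP[dl /= dl0 H].
exists (dl / 2) => [|a b Xa Xb Ha Hb]; first by lra.
rewrite distrC; apply: (H (a, b)) => //.
by split; rewrite -ball_normE /= distrC; lra.
Qed.

(** For [x] in [X], this is the section [K (., x) e_q], selected by the functional it represents. *)
Definition feature (q : 'I_Q) (x : E) : F :=
  xget 0 [set k : F | forall f : F, rk_ip f k = rk_ev f x q 0].

Lemma rk_ip_feature q x (f : F) : X x -> rk_ip f (feature q x) = rk_ev f x q 0.
Proof.
move=> Xx; have [k [_ Hk]] := rk_reproducing F (delta_mx q 0) Xx.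
have : [set k : F | forall f : F, rk_ip f k = rk_ev f x q 0] (feature q x).
  apply: (xgetI _ (x := k)) => g; rewrite Hk /dotp (bigD1 q) //= big1 => [|i iq].
    by rewrite addr0 mxE !eqxx mulr1.
  by rewrite mxE (negPf iq) mulr0.
by apply.
Qed.

Lemma rk_ev_feature q x x' a : X x -> X x' ->
  rk_ev (feature q x) x' a 0 = K x' x a q.
Proof.
move=> Xx Xx'; have [k [Hk1 Hk2]] := rk_reproducing F (delta_mx q 0) Xx.
have -> : feature q x = k.
  apply: rk_ip_ext => h; rewrite rk_ip_feature // Hk2 /dotp (bigD1 q) //= big1.
    by rewrite addr0 mxE !eqxx mulr1.
  by move=> i iq; rewrite mxE (negPf iq) mulr0.
rewrite Hk1 // mxE (bigD1 q) //= big1 => [|i iq].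
  by rewrite addr0 mxE !eqxx mulr1.
by rewrite mxE (negPf iq) mulr0.
Qed.

Lemma rk_fd_cvg l (Phi : E -> F) x v (f : F) :
  fd_cvg l Phi x v -> fd_cvg l (fun y => rk_ip f (Phi y)) x (rk_ip f v).
Proof.
move=> H e e0; have p0 : 0 < `|f| + 1 by rewrite ltr_wpDl.
have [dl dl0 Hdl] := H _ (divr_gt0 e0 p0); exists dl => // hs Hs Hr.
have <- : rk_ip f (fd l hs Phi x) = fd l hs (fun y => rk_ip f (Phi y)) x.
  by apply: fd_map => a u w; rewrite rk_ipZr rk_ipBr.
rewrite -rk_ipBr; apply: le_trans (rk_cauchy_schwarz _ _) _.
have := Hdl hs Hs Hr; rewrite ler_pdivlMr // => H1.
by apply: le_trans H1; rewrite mulrC ler_wpM2l // lerDl.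
Qed.

Lemma ball_interior (x : E) : U x ->
  exists2 dl : R, 0 < dl & forall y, `|y - x| <= dl -> U y.
Proof.
move=> Ux; have : nbhs x U by apply: open_nbhs_nbhs; split=> //; exact: open_interior.
move=> /nbhs_ballP[dl /= dl0 H]; exists (dl / 2) => [|y Hy]; first by lra.
by apply: H; rewrite -ball_normE /= distrC; lra.
Qed.

Section Word.
Variables (Phi : E -> F) (w : E -> E -> R).
Hypothesis wE : forall y z, U y -> U z -> rk_ip (Phi y) (Phi z) = w y z.

Definition smooth_word (l : seq 'I_d) : Prop :=
  [/\ forall y, U y -> ex_iter_pderiv U l (w y),
      forall z, U z -> ex_iter_pderiv U l (fun y => iter_pderiv l (w y) z) &
      exists2 G : E * E -> R, {within X `*` X, continuous G} &
        forall y z, U y -> U z ->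
          G (y, z) = iter_pderiv l (fun y => iter_pderiv l (w y) z) y].

Lemma rk_ip_fd l hs hs' (x : E) :
  (forall y, `|y - x| <= reach hs -> U y) ->
  (forall y, `|y - x| <= reach hs' -> U y) ->
  rk_ip (fd l hs Phi x) (fd l hs' Phi x)
  = fd l hs (fun y => fd l hs' (w y) x) x.
Proof.
move=> H1 H2; rewrite rk_ipC.
rewrite (@fd_map _ _ _ _ (rk_ip (fd l hs' Phi x)))
  => [|a u v]; last by rewrite rk_ipZr rk_ipBr.
apply: fd_eq => y /H1 Uy /=; rewrite rk_ipC.
rewrite (@fd_map _ _ _ _ (rk_ip (Phi y)))
  => [|a u v]; last by rewrite rk_ipZr rk_ipBr.
by apply: fd_eq => z /H2 Uz /=; exact: wE.
Qed.

Lemma feature_fd_cvg l (x : E) : smooth_word l -> U x -> exists v, fd_cvg l Phi x v.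
Proof.
move=> [e1 e2 [G cG GE]] Ux; apply: fd_cvg_complete => e e0.
have XU : U `<=` X by exact: interior_subset.
(* The squared distance of two differences combines three inner products with coefficients 1, -2, 1.
   Each is close to [G (x, x)], which cancels, leaving four errors of [e ^+ 2 / 4]. *)
have e'0 : 0 < e ^+ 2 / 4 by rewrite divr_gt0 ?exprn_gt0.
have [d1 d10 Hd1] := within_continuous2_dist cG (XU _ Ux) e'0.
have [d2 d20 Hd2] := ball_interior Ux.
exists (Num.min d1 d2) => [|hs hs' Hs Hs']; first by rewrite lt_min d10.
rewrite !le_min => /andP[r1 r2] /andP[r1' r2'].
have HU k : reach k <= d2 -> forall y, `|y - x| <= reach k -> U y.
  by move=> Hk y Hy; apply: Hd2; exact: le_trans Hy Hk.
have near_G h k : steps l h -> steps l k -> reach h <= d1 -> reach k <= d1 ->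
    reach h <= d2 -> reach k <= d2 ->
    `|rk_ip (fd l h Phi x) (fd l k Phi x) - G (x, x)| <= e ^+ 2 / 4.
  move=> sh sk h1 k1 h2 k2; rewrite rk_ip_fd; try exact: HU.
  have [xi [xi' [H1 H2 ->]]] :=
    fd_gram_mvt (@open_interior _ X) sh sk (HU _ h2) (HU _ k2) e1 e2.
  have U1 := HU _ h2 _ H1; have U2 := HU _ k2 _ H2.
  rewrite -GE //; apply: Hd1; [exact: XU|exact: XU| |].
    exact: le_trans H1 h1.
  exact: le_trans H2 k1.
rewrite -(@ler_pXn2r _ 2) ?nnegrE ?(ltW e0) // rk_normsq rk_ipBl !rk_ipBr.
rewrite (rk_ipC (fd l hs' Phi x) (fd l hs Phi x)).
have := near_G hs hs Hs Hs r1 r1 r2 r2.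
have := near_G hs hs' Hs Hs' r1 r1' r2 r2'.
have := near_G hs' hs' Hs' Hs' r1' r1' r2' r2'.
rewrite !ler_norml => /andP[? ?] /andP[? ?] /andP[? ?].
by lra.
Qed.

(** [Psi x] is the norm limit of the differences of [Phi] at [x]; pairing with [f] commutes with
    differences and passes to the limit. The suffixes of [l] account for the intermediate
    derivatives. *)
Lemma reproducing_word l : (forall k, smooth_word (drop k l)) ->
  exists Psi : E -> F, forall f : F,
    ex_iter_pderiv U l (fun y => rk_ip f (Phi y)) /\
    forall x, U x -> iter_pderiv l (fun y => rk_ip f (Phi y)) x = rk_ip f (Psi x).
Proof.
move=> H; have /(_ 0) := H; rewrite drop0 => H0.
exists (fun x => xget 0 [set v | fd_cvg l Phi x v]) => f.
have [|e1 E1] := @fd_cvg_iter_pderiv R d U l (fun y => rk_ip f (Phi y))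
  (@open_interior _ X).
  move=> k x Ux; have [v Hv] := feature_fd_cvg (H k) Ux.
  by exists (rk_ip f v); exact: rk_fd_cvg.
split=> // x Ux; apply: E1 => //; apply: rk_fd_cvg.
have [v Hv] := feature_fd_cvg H0 Ux.
have : [set v | fd_cvg l Phi x v] (xget 0 [set v | fd_cvg l Phi x v]).
  exact: (xgetI _ (x := v)).
by [].
Qed.

(** Differentiating [<Phi y, Phi z>] in [z], then in [y], replaces each [Phi] by [Psi]. The Gram
    function of [Psi] therefore extends continuously to [X x X], which controls [Psi] near
    non-interior points. *)
Lemma reproducing_word_gram l (Psi : E -> F) y z : smooth_word l ->
  (forall f : F,
    ex_iter_pderiv U l (fun y => rk_ip f (Phi y)) /\
    forall x, U x -> iter_pderiv l (fun y => rk_ip f (Phi y)) x = rk_ip f (Psi x)) ->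
  U y -> U z ->
  rk_ip (Psi y) (Psi z) = iter_pderiv l (fun y => iter_pderiv l (w y) z) y.
Proof.
move=> [e1 e2 _] H Uy Uz.
have w1 t : U t -> iter_pderiv l (w t) z = rk_ip (Phi t) (Psi z).
  move=> Ut; rewrite -(H (Phi t)).2 //.
  have wt s : U s -> w t s = rk_ip (Phi t) (Phi s) by move=> Us; rewrite wE.
  by rewrite -(iter_pderiv_eq l (@open_interior _ X) wt).
have w2 t : U t -> iter_pderiv l (w t) z = rk_ip (Psi z) (Phi t).
  by move=> Ut; rewrite w1 // rk_ipC.
rewrite (iter_pderiv_eq l (@open_interior _ X) w2) //.
by rewrite (H _).2 // rk_ipC.
Qed.

End Word.

End ReproducingDerivatives.

(** Removing the first letter lowers by one the multiplicity of the first index that occurs; earlier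
    indices have multiplicity 0. *)
Lemma flatten_nseq_behead (T : eqType) (s : seq T) (r : T -> nat) : uniq s ->
  exists2 r' : T -> nat, forall i, (r' i <= r i)%N &
    behead (flatten [seq nseq (r i) i | i <- s])
    = flatten [seq nseq (r' i) i | i <- s].
Proof.
elim: s => [|a s IH] /=; first by exists r.
move=> /andP[anis us]; case ra: (r a) => [|m] /=.
  have [r1 Hr1 E1] := IH us.
  exists (fun i => if i == a then 0%N else r1 i).
    by move=> i; case: eqP.
  rewrite eqxx /= E1; congr flatten; apply/eq_in_map => i ins.
  by case: eqP => // ia; rewrite ia in ins; rewrite ins in anis.
exists (fun i => if i == a then m else r i).
  by move=> i; case: eqP => // ->; rewrite ra.
rewrite eqxx; congr (_ ++ flatten _); apply/eq_in_map => i ins.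
by case: eqP => // ia; rewrite ia in ins; rewrite ins in anis.
Qed.

(* The suffixes of [dirs r] are again words of multi-indices, of order at most
   that of r; hence [kernel_Css] covers all the intermediate derivatives. *)
Lemma dirs_drop (d k : nat) (r : 'I_d -> nat) :
  exists2 r' : 'I_d -> nat, (mindex_order r' <= mindex_order r)%N &
    drop k (dirs r) = dirs r'.
Proof.
elim: k r => [|k IH] r; first by exists r; rewrite ?drop0.
have [r1 Hr1 E1] := flatten_nseq_behead r (enum_uniq 'I_d).
have [r2 Hr2 E2] := IH r1; exists r2.
  by apply: leq_trans Hr2 _; exact: leq_sum.
by rewrite -E2 -addn1 -drop_drop drop1 /dirs E1.
Qed.

(** * Representers of differential operators on all of [X] *)

Section ReproducingOperators.
Variables (R : realType) (d Q s : nat) (X : set 'rV[R]_d).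
Variables (K : 'rV[R]_d -> 'rV[R]_d -> 'M[R]_Q) (F : rkhs X K).
Hypotheses (HX : X `<=` closure (interior X)) (HK : is_kernel X K)
  (HKs : kernel_Css s X K).
Local Notation E := 'rV[R]_d.
Local Notation U := (interior X).

Lemma interior_in (x : E) : U x -> X x.
Proof. exact: interior_subset. Qed.

(** Only derivatives at interior points are read; at other points the two image filters coincide, so
    their limits agree whether or not they converge. *)
Lemma mpderiv_on_eq r (g1 g2 : E -> R) x : (forall y, X y -> g1 y = g2 y) ->
  mpderiv_on X r g1 x = mpderiv_on X r g2 x.
Proof.
move=> H; have HU y : U y -> mpderiv r g1 y = mpderiv r g2 y.
  apply: (iter_pderiv_eq (dirs r) (@open_interior _ X)) => z Uz.
  exact/H/interior_in.
rewrite /mpderiv_on; case: ifPn => [/set_mem /HU //|_].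
congr lim; apply/funext => A; apply/propext.
split; [apply: (@filterS _ (nbhs x) _ [set y | U y -> A (mpderiv r g1 y)])
  |apply: (@filterS _ (nbhs x) _ [set y | U y -> A (mpderiv r g2 y)])] => y Hy Uy;
  by [rewrite /= -HU //; exact: Hy|rewrite /= HU //; exact: Hy].
Qed.

Lemma feature_gram q y z : U y -> U z ->
  rk_ip (feature F q y) (feature F q z) = K y z q q.
Proof.
move=> /interior_in Xy /interior_in Xz.
by rewrite rk_ip_feature // rk_ev_feature // HK.1 // mxE.
Qed.

Lemma kernel_smooth_word q r k : (mindex_order r <= s)%N ->
  smooth_word X (fun y z => K y z q q) (drop k (dirs r)).
Proof.
move=> rs; have [r' rr' ->] := dirs_drop k r.
have [[e1 e2] [G [cG GE]]] := (HKs q q).2 r' (leq_trans rr' rs).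
by split; [exact: e1|exact: e2|exists G; [exact: cG|move=> y z; exact: GE]].
Qed.

Lemma reproducing_interior q r : (mindex_order r <= s)%N ->
  exists Psi : E -> F,
   (forall f : F, forall x, U x ->
     mpderiv r (fun y => rk_ev f y q 0) x = rk_ip f (Psi x)) /\
   exists2 G : E * E -> R, {within X `*` X, continuous G} &
     forall y z, U y -> U z -> rk_ip (Psi y) (Psi z) = G (y, z).
Proof.
move=> rs; have S k := kernel_smooth_word q k rs.
have [Psi HPsi] := reproducing_word (@feature_gram q) S.
exists Psi; split=> [f x Ux|].
  rewrite -(HPsi f).2 //; apply: (iter_pderiv_eq _ (@open_interior _ X)) => // y Uy.
  by rewrite rk_ip_feature //; exact: interior_in.
have := S 0; rewrite drop0 => S0; have [_ _ [G cG GE]] := S0.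
exists G => // y z Uy Uz; rewrite GE //.
exact: (reproducing_word_gram (@feature_gram q) S0 HPsi).
Qed.

(** At a non-interior point the representer is the limit of the interior representers [Psi y], which
    are Cauchy because their Gram function extends continuously to [(x, x)]. *)
Lemma reproducing_mpderiv q r x : (mindex_order r <= s)%N -> X x ->
  exists v : F, forall f : F,
    mpderiv_on X r (fun y => rk_ev f y q 0) x = rk_ip f v.
Proof.
move=> rs Xx; have [Psi [HPsi [G cG GE]]] := reproducing_interior q rs.
case: (boolP (x \in (U : set E))) => xU.
  by exists (Psi x) => f; rewrite /mpderiv_on xU; apply: HPsi; exact: set_mem xU.
(* Every point of [X] is a limit of interior points, so limits along this filter are unique. *)
have PF : ProperFilter (within U (nbhs x)) by apply: within_nbhs_proper; exact: HX.
have cP : cvg (Psi y @[y --> within U (nbhs x)]).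
  apply: cauchy_cvg; apply: cauchy_exP => e e0.
  have e'0 : 0 < e ^+ 2 / 16 by rewrite divr_gt0 ?exprn_gt0.
  (* |Psi y - Psi z|^2 = G (y, y) - 2 G (y, z) + G (z, z) *)
  have [dl dl0 Hdl] := within_continuous2_dist cG Xx e'0.
  have near_x : \forall y \near within U (nbhs x), U y /\ `|y - x| <= dl.
    rewrite near_withinE; apply/nbhs_ballP; exists dl => //= y.
    by rewrite -ball_normE /= distrC => /ltW.
  have [y [Uy yx]] := filter_ex near_x; exists (Psi y).
  apply: filterS near_x => z [Uz zx]; rewrite -ball_normE /=.
  rewrite -(@ltr_pXn2r _ 2) ?nnegrE ?(ltW e0) // rk_normsq rk_ipBl !rk_ipBr.
  rewrite (rk_ipC (Psi z) (Psi y)) !GE //.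
  have Xy := interior_in Uy; have Xz := interior_in Uz.
  have := Hdl y y Xy Xy yx yx; have := Hdl y z Xy Xz yx zx.
  have := Hdl z z Xz Xz zx zx.
  rewrite !ler_norml => /andP[? ?] /andP[? ?] /andP[? ?].
  by lra.
exists (lim (Psi y @[y --> within U (nbhs x)])) => f.
rewrite /mpderiv_on (negPf xU); apply: cvg_lim => //.
apply: (@cvg_trans _ (rk_ip f (Psi y) @[y --> within U (nbhs x)])).
  apply: near_eq_cvg; rewrite near_withinE; near=> y => Uy.
  by rewrite HPsi.
apply: (@cvg_comp _ _ _ Psi (rk_ip f) _ _ _ cP).
exact: rk_ip_continuous.
Unshelve. all: by end_near. Qed.

Lemma reproducing_diffop1 (D : diffop1 R d s) q x : X x ->
  exists v : F, forall f : F,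
    diffop1_app X D (fun y => rk_ev f y q 0) x = rk_ip f v.
Proof.
move=> Xx; case: D => t Ht; rewrite /diffop1_app /=.
elim: t Ht => [_|[a r] t IH] /=.
  by exists 0 => f; rewrite big_nil rk_ip0r.
move=> /andP[/= rs /IH[v Hv]].
have [v1 Hv1] := reproducing_mpderiv q rs Xx.
by exists (a *: v1 + v) => f; rewrite big_cons Hv Hv1 rk_ipDr rk_ipZr.
Qed.

Lemma reproducing_diffop (D : diffop R d Q s) x : X x ->
  exists v : F, forall f : F, diffop_app X D (rk_ev f) x = rk_ip f v.
Proof.
move=> Xx; have [v Hv] := choice (fun q => reproducing_diffop1 (do_op D q) q Xx).
exists (\sum_q do_coef D q *: v q) => f; rewrite rk_ip_sumr.
by apply: eq_bigr => q _; rewrite rk_ipZr Hv.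
Qed.

(** The values of the representer [v] are found by pairing it with features, that is, by applying
    [D] to the sections of [K]. Symmetry of [K] turns this into [DK], and an element of [F] is
    determined by its values on [X]. *)
Lemma diffop_app_DKsec (D : diffop R d Q s) (f : F) x : X x ->
  diffop_app X D (rk_ev f) x = rk_ip f (DKsec F D x).
Proof.
move=> Xx; have [v Hv] := reproducing_diffop D Xx.
suff -> : DKsec F D x = v by exact: Hv.
have vE x' : X x' -> rk_ev v x' = DK X K D x' x.
  move=> Xx'; apply/colP => a; rewrite -rk_ip_feature // rk_ipC -Hv /DK.
  rewrite summxE; apply: eq_bigr => q _; rewrite !mxE; congr (_ * _).
  rewrite (bigD1 q) //= big1 => [|b bq]; last first.
    by rewrite [delta_mx _ _ _ _]mxE (negPf bq) mulr0.
  rewrite addr0 !mxE !eqxx mulr1.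
  apply: eq_bigr => t _; congr (_ * _); apply: mpderiv_on_eq => y Xy.
  by rewrite rk_ev_feature // HK.1 // mxE.
have H0 : [set g : F | forall x', X x' -> rk_ev g x' = DK X K D x' x] (DKsec F D x).
  exact: (xgetI _ (x := v)).
by apply: rk_ev_inj => x' Xx'; rewrite vE // H0.
Qed.

End ReproducingOperators.

(** * Tightened constraints *)

Section QuadraticForms.
Variables (R : realType) (n : nat).
Implicit Types (A : 'M[R]_n) (u : 'cV[R]_n).

Definition qform A u : R := (u^T *m A *m u) 0 0.

Lemma qformD A A' u : qform (A + A') u = qform A u + qform A' u.
Proof. by rewrite /qform mulmxDr mulmxDl mxE. Qed.

Lemma qformN A u : qform (- A) u = - qform A u.
Proof. by rewrite /qform mulmxN mulNmx mxE. Qed.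

Lemma loewner_leP A A' :
  loewner_le A A' <-> forall u, qform A u <= qform A' u.
Proof.
by split=> H u; have := H u; rewrite -/(qform _ u) qformD qformN subr_ge0.
Qed.

Lemma qformE A u :
  qform A u = \sum_i \sum_j (u i 0 * u j 0) * A i j.
Proof.
rewrite /qform mxE exchange_big /=; apply: eq_bigr => j _.
rewrite mxE mulr_suml; apply: eq_bigr => i _; rewrite mxE; ring.
Qed.

Lemma qform0 u : qform 0 u = 0.
Proof. by rewrite /qform mulmx0 mul0mx mxE. Qed.

Lemma qform_diag (a : 'rV[R]_n) u : qform (diag_mx a) u = \sum_i u i 0 ^+ 2 * a 0 i.
Proof.
rewrite qformE; apply: eq_bigr => i _; rewrite (bigD1 i) //= big1 => [|j ji].
  by rewrite addr0 mxE eqxx mulr1n expr2.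
by rewrite mxE eq_sym (negPf ji) mulr0n mulr0.
Qed.

Lemma qform_scalar (t : R) u : qform t%:M u = t * dotp u u.
Proof.
rewrite -diag_const_mx qform_diag mulr_sumr; apply: eq_bigr => i _.
by rewrite mxE expr2 mulrC.
Qed.

Lemma dotp_ge0 u : 0 <= dotp u u.
Proof. by apply: sumr_ge0 => i _; rewrite -expr2 sqr_ge0. Qed.

Lemma dotpZ (a : R) u : dotp (a *: u) (a *: u) = a ^+ 2 * dotp u u.
Proof.
by rewrite /dotp mulr_sumr; apply: eq_bigr => i _; rewrite mxE; ring.
Qed.

Lemma enormZ (a : R) u : enorm (a *: u) = `|a| * enorm u.
Proof. by rewrite /enorm dotpZ sqrtrM ?sqr_ge0 // sqrtr_sqr. Qed.

Lemma dotp_eq0 u : dotp u u = 0 -> u = 0.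
Proof.
move=> /eqP; rewrite psumr_eq0 => [/allP H|i _]; last by rewrite -expr2 sqr_ge0.
apply/colP => i; have := H i; rewrite mem_index_enum -expr2 sqrf_eq0 mxE.
by move=> /(_ isT) /eqP.
Qed.

End QuadraticForms.


Section Tightening.
Variables (R : realType) (d Q s B : nat) (X : set 'rV[R]_d).
Variables (K : 'rV[R]_d -> 'rV[R]_d -> 'M[R]_Q) (F : rkhs X K).
Hypotheses (HX : X `<=` closure (interior X)) (HK : is_kernel X K)
  (HKs : kernel_Css s X K).
Variables (N : 'rV[R]_d -> R) (HN : is_norm N).
Variable c : shape_constraint F s B.

(** The vector whose norm is maximized in [soc_eta], here for [u] of any length. *)
Definition soc_gap (xt x : 'rV[R]_d) (u : 'cV[R]_(sc_dim c)) : F :=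
  \sum_(p1 < sc_dim c) \sum_(p2 < sc_dim c)
    (u p1 0 * u p2 0) *: (DKsec F (sc_op c p1 p2) xt - DKsec F (sc_op c p1 p2) x).

Lemma soc_gapZ xt x a u : soc_gap xt x (a *: u) = a ^+ 2 *: soc_gap xt x u.
Proof.
rewrite /soc_gap scaler_sumr; apply: eq_bigr => p1 _.
rewrite scaler_sumr; apply: eq_bigr => p2 _.
by rewrite scalerA !mxE; congr (_ *: _); ring.
Qed.

Lemma sc_opmxE (h : F) x p1 p2 : X x ->
  sc_opmx c h x p1 p2 = rk_ip h (DKsec F (sc_op c p1 p2) x).
Proof.
by move=> Xx; rewrite [LHS]mxE; exact: (diffop_app_DKsec HX HK HKs).
Qed.

Lemma qform_sc_mx (f : F) b x u :
  qform (sc_mx c f b x) u = qform (sc_opmx c (f - sc_f0 c) x) u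
    + qform (diag_mx (sc_Gamma c *m b - sc_b0 c)^T) u.
Proof. exact: qformD. Qed.

Lemma qform_soc_gap (h : F) xt x u : X xt -> X x ->
  qform (sc_opmx c h xt) u - qform (sc_opmx c h x) u = rk_ip h (soc_gap xt x u).
Proof.
move=> Xt Xx; rewrite (qformE (sc_opmx c h xt) u) (qformE (sc_opmx c h x) u).
rewrite -sumrB /soc_gap rk_ip_sumr; apply: eq_bigr => p1 _.
rewrite -sumrB rk_ip_sumr; apply: eq_bigr => p2 _.
rewrite rk_ipZr rk_ipBr mulrBr.
by congr (_ * _ - _ * _); exact: sc_opmxE.
Qed.

Lemma soc_eta_ge0 xt delta : X xt -> 0 < delta -> (0 <= soc_eta N c xt delta)%E.
Proof.
move=> Xt d0; apply: ereal_sup_ubound.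
pose u : 'cV[R]_(sc_dim c) := delta_mx (sc_idx c) 0.
exists xt, u; split.
- split=> //; rewrite subrr; have [_ HZ _] := HN.
  by have := HZ 0 0; rewrite scale0r normr0 mul0r => ->; exact: ltW.
- rewrite /enorm /dotp (bigD1 (sc_idx c)) //= big1 => [|i ni].
    by rewrite addr0 !mxE !eqxx mulr1 sqrtr1.
  by rewrite !mxE (negPf ni) mulr0.
- rewrite big1 ?normr0 // => p1 _; rewrite big1 // => p2 _.
  by rewrite subrr scaler0.
Qed.

(** Both sides are quadratic in [u], which reduces to unit vectors and Cauchy-Schwarz. Only the
    product of [soc_eta] and [|h|] is assumed finite, which covers an infinite [soc_eta] with
    [h = 0]. *)
Lemma soc_gap_le xt delta x u t (h : F) : nball X N xt delta x ->
  (soc_eta N c xt delta * `|h|%:E)%E = t%:E ->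
  `|rk_ip h (soc_gap xt x u)| <= t * dotp u u.
Proof.
move=> Bx Ht.
have [u0|un] := eqVneq (dotp u u) 0.
  have -> : u = 0 *: u by rewrite scale0r (dotp_eq0 u0).
  by rewrite soc_gapZ dotpZ expr0n /= scale0r rk_ip0r normr0 mul0r mulr0.
have up : 0 < dotp u u by rewrite lt_neqAle eq_sym un dotp_ge0.
have ep : 0 < enorm u by rewrite sqrtr_gt0.
pose v := (enorm u)^-1 *: u.
have uv : u = enorm u *: v by rewrite scalerA divff ?scale1r // gt_eqF.
have v1 : enorm v = 1 by rewrite enormZ normfV gtr0_norm // mulVf // gt_eqF.
rewrite uv soc_gapZ rk_ipZr normrM dotpZ.
have -> : dotp v v = 1.
  move: v1; rewrite /enorm => /(congr1 (fun z => z ^+ 2)).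
  by rewrite sqr_sqrtr ?dotp_ge0 // expr1n.
rewrite mulr1 mulrC [`|enorm u ^+ 2|]ger0_norm ?sqr_ge0 // ler_wpM2r ?sqr_ge0 //.
apply: le_trans (rk_cauchy_schwarz _ _) _; rewrite mulrC -lee_fin -Ht EFinM.
apply: lee_wpmul2r; first by rewrite lee_fin.
by apply: ereal_sup_ubound; exists x, v.
Qed.

Lemma C_soc_sub M (xt : 'I_M -> 'rV[R]_d) (delta : 'I_M -> R) z x :
  sc_set c `<=` X -> soc_cover N c xt delta -> C_soc N c xt delta z ->
  sc_set c x -> loewner_le 0 (sc_mx c z.1 z.2 x).
Proof.
move=> cX [Xt d0 cov] Hz cx; have [m _ Bx] := cov x cx.
have /= [tf /loewner_leP H] := Hz m.
apply/loewner_leP => u; rewrite (qform0 u).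
have H1 := H u; rewrite (qform_scalar _ u) in H1.
rewrite (qform_sc_mx z.1 z.2 (xt m) u) in H1.
rewrite (qform_sc_mx z.1 z.2 x u).
have H2 := soc_gap_le u Bx (esym (fineK tf)).
rewrite -(qform_soc_gap (z.1 - sc_f0 c) u (Xt m) (cX x cx)) in H2.
have aux (p q r t : R) : t <= p + r -> `|p - q| <= t -> 0 <= q + r.
  by move=> + /ler_normlP[]; lra.
exact: aux H1 H2.
Qed.

Lemma sc_mx_shift (f : F) b (a : R) beta x :
  sc_mx c f (b + a *: beta) x
  = sc_mx c f b x + diag_mx (a *: (sc_Gamma c *m beta))^T.
Proof.
rewrite /sc_mx mulmxDr -scalemxAr [_ + a *: _ - _]addrAC.
by rewrite [in LHS]linearD [in LHS]raddfD [in LHS]addrA.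
Qed.

Lemma C_soc_shift M (xt : 'I_M -> 'rV[R]_d) (delta : 'I_M -> R) (f : F) b beta
    (e k : R) :
  soc_cover N c xt delta ->
  (forall m, loewner_le 0 (sc_mx c f b (xt m))) ->
  (forall m, (soc_eta N c (xt m) (delta m) <= e%:E)%E) ->
  0 <= e -> (forall p, `|f - sc_f0 c| <= k * (sc_Gamma c *m beta) p 0) ->
  C_soc N c xt delta (f, b + (e * k) *: beta).
Proof.
move=> [Xt d0 _] H He e0 Hk m /=.
have eta0 := soc_eta_ge0 (Xt m) (d0 m).
have ef : soc_eta N c (xt m) (delta m) \is a fin_num.
  by rewrite ge0_fin_numE //; apply: le_lt_trans (He m) _; rewrite ltry.
split; first by rewrite fin_numM.
apply/loewner_leP => u; rewrite (sc_mx_shift f b (e * k) beta (xt m)).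
rewrite (qformD (sc_mx c f b (xt m)) _ u).
have /loewner_leP /(_ u) := H m; rewrite (qform0 u) => H0.
rewrite (qform_scalar _ u) (qform_diag _ u) -[leLHS]add0r.
apply: lerD; first exact: H0.
rewrite fineM //= /dotp mulr_sumr; apply: ler_sum => p _.
rewrite 2!mxE expr2 mulrC; apply: ler_wpM2l; first by rewrite -expr2 sqr_ge0.
rewrite -mulrA; apply: ler_pM => //.
- exact: fine_ge0.
- by rewrite -lee_fin fineK.
Qed.

End Tightening.

(** * The tightening by coverings in the RKHS *)

Section OmegaTightening.
Variables (R : realType) (d Q s B : nat) (X : set 'rV[R]_d).
Variables (K : 'rV[R]_d -> 'rV[R]_d -> 'M[R]_Q) (F : rkhs X K).
Hypotheses (HX : X `<=` closure (interior X)) (HK : is_kernel X K)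
  (HKs : kernel_Css s X K).
Variable c : shape_constraint F s B.
Hypotheses (c1 : sc_dim c = 1%N) (cX : sc_set c `<=` X).

Definition sc_offset (b : 'cV[R]_B) : R :=
  - sc_b0 c (sc_idx c) 0 + (sc_Gamma c *m b) (sc_idx c) 0.

Lemma loewner_dim1 (f : F) b x : X x -> loewner_le 0 (sc_mx c f b x) <->
  0 <= rk_ip (f - sc_f0 c) (DKsec F (sc_op c (sc_idx c) (sc_idx c)) x)
       + sc_offset b.
Proof.
move=> Xx.
have I1 (i : 'I_(sc_dim c)) : i = sc_idx c.
  by apply/val_inj; case: i => i /=; rewrite c1; case: i.
have big1E (G : 'I_(sc_dim c) -> R) : \sum_i G i = G (sc_idx c).
  by rewrite (bigD1 (sc_idx c)) //= big1 ?addr0 // => i; rewrite (I1 i) eqxx.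
rewrite -(diffop_app_DKsec HX HK HKs) //.
have E1 u : qform (sc_mx c f b x) u = u (sc_idx c) 0 ^+ 2 *
    (diffop_app X (sc_op c (sc_idx c) (sc_idx c)) (rk_ev (f - sc_f0 c)) x
     + sc_offset b).
  by rewrite qformE !big1E /sc_mx /sc_offset !mxE eqxx mulr1n; ring.
split=> [/loewner_leP H|H].
  have := H (delta_mx (sc_idx c) 0).
  by rewrite qform0 E1 mxE !eqxx expr1n mul1r.
by apply/loewner_leP => u; rewrite qform0 E1 mulr_ge0 // sqr_ge0.
Qed.

(** Writing [h] through the certificate, Cauchy-Schwarz on each ball and [xi j >= 0] on each
    half-space give nonnegativity on Omega; continuity extends it to the closure, which contains the
    representer at [x]. *)
Lemma C_omega_sub M (o : 'I_M -> omega_data R F) z x :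
  omega_cover c o -> C_omega c o z ->
  sc_set c x -> loewner_le 0 (sc_mx c z.1 z.2 x).
Proof.
move=> [wf cov] Hz cx; apply/loewner_dim1; first exact: cX.
set h := z.1 - sc_f0 c; set phi := DKsec F _ x.
have [m _ clm] : (\bigcup_m closure (omega_set (o m))) phi by apply: cov; exists x.
have [g [xi [_ xi0 H0 H1]]] := Hz m.
have hE : h = \sum_j g j - \sum_j xi j *: om_v (o m) j.
  by apply/eqP; rewrite eq_sym -subr_eq0 addrC addrA H1.
have low k : omega_set (o m) k -> 0 <= rk_ip h k + sc_offset z.2.
  move=> [kB kH]; rewrite hE rk_ipBl !rk_ip_suml.
  apply: le_trans H0 _; rewrite -/(sc_offset _).
  have A1 : \sum_j rk_ip (g j) (om_c (o m) j) - \sum_j om_r (o m) j * `|g j|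
      <= \sum_j rk_ip (g j) k.
    rewrite -sumrB; apply: ler_sum => j _; rewrite lerBlDr -lerBlDl -rk_ipBr.
    apply: le_trans (ler_norm _) _; apply: le_trans (rk_cauchy_schwarz _ _) _.
    by rewrite mulrC ler_wpM2r // distrC ltW.
  have A2 : \sum_j rk_ip (xi j *: om_v (o m) j) k <= \sum_j xi j * om_rho (o m) j.
    by apply: ler_sum => j _; rewrite rk_ipZl ler_wpM2l // ltW.
  lra.
apply/ler_addgt0Pl => e e0.
have p0 : 0 < `|h| + 1 by rewrite ltr_wpDl.
have [k [kO]] := clm _ (nbhsx_ballx phi _ (divr_gt0 e0 p0)).
rewrite -ball_normE /= => /ltW; rewrite ler_pdivlMr // => kphi.
have := low k kO; have := rk_cauchy_schwarz h (phi - k).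
rewrite rk_ipBr => H2 H3.
have : `|phi - k| * `|h| <= e by apply: le_trans kphi; rewrite ler_wpM2l // lerDl.
by move: H2; rewrite ler_norml => /andP[]; lra.
Qed.

Lemma ediam_closure (A : set F) (e : R) phi k : (ediam A <= e%:E)%E ->
  closure A phi -> A k -> `|phi - k| <= e.
Proof.
move=> He clA Ak; apply/ler_addgt0Pl => t t0.
have [l [Al]] := clA _ (nbhsx_ballx phi _ t0).
rewrite -ball_normE /= => pl.
apply: le_trans (ler_distD l _ _) _; apply: lerD; first exact: ltW.
rewrite -lee_fin; apply: le_trans He; apply: ereal_sup_ubound.
by exists l, k.
Qed.

(** The original constraint holds at a representer [phi] in the closure of Omega. Every [g] in Omega
    is within [e] of [phi], so replacing [phi] by [g] costs at most [e * |f - f0|], which the shift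
    pays for; [omega_dual] then supplies the certificate. *)
Lemma C_omega_shift M (o : 'I_M -> omega_data R F) (f : F) b beta (e k : R) :
  omega_cover c o ->
  (forall m, closure (omega_set (o m)) `&` Phi_set c !=set0) ->
  (forall x, sc_set c x -> loewner_le 0 (sc_mx c f b x)) ->
  (forall m, (ediam (omega_set (o m)) <= e%:E)%E) ->
  0 <= e -> (forall p, `|f - sc_f0 c| <= k * (sc_Gamma c *m beta) p 0) ->
  C_omega c o (f, b + (e * k) *: beta).
Proof.
move=> [wf _] meet H He e0 Hk m /=.
have [r0 _ ne] := wf m.
have [phi [clphi [x cx phiE]]] := meet m.
have := (omega_dual (gam := sc_offset (b + (e * k) *: beta)) r0 ne).
move=> /(_ (f - sc_f0 c)); apply => g gO.
have /loewner_dim1 := H x cx; rewrite phiE => /(_ (cX cx)) H0.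
have H1 : sc_offset (b + (e * k) *: beta)
    = sc_offset b + e * (k * (sc_Gamma c *m beta) (sc_idx c) 0).
  by rewrite /sc_offset mulmxDr -scalemxAr !mxE; ring.
have H2 := rk_cauchy_schwarz (f - sc_f0 c) (phi - g).
have H3 := ediam_closure (He m) clphi gO.
have H4 : `|f - sc_f0 c| * `|phi - g| <= (k * (sc_Gamma c *m beta) (sc_idx c) 0) * e.
  exact: ler_pM.
move: H2; rewrite H1 rk_ipBr ler_norml => /andP[_ H2].
lra.
Qed.

End OmegaTightening.

(** * Constants of the bound *)

Lemma is_minimizer_optval (R : realType) (T : Type) (L : T -> \bar R) (S : set T) z :
  is_minimizer L S z -> optval L S = L z.
Proof.
move=> [Sz Lz]; apply/eqP; rewrite eq_le; apply/andP; split.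
  by apply: ereal_inf_lbound; exists z.
by apply: le_ereal_inf_tmp => _ [z' Sz' <-]; exact: Lz.
Qed.

Section Constants.
Variables (R : realType) (d Q s B n : nat) (X : set 'rV[R]_d).
Variables (K : 'rV[R]_d -> 'rV[R]_d -> 'M[R]_Q) (F : rkhs X K).
Variables (c : 'I_n -> shape_constraint F s B) (beta : 'cV[R]_B).
Hypothesis Hbeta : forall i (p : 'I_(sc_dim (c i))),
  0 < (sc_Gamma (c i) *m beta) p 0.

Let slopes : set R := [set y | exists i (p : 'I_(sc_dim (c i))),
  y = (sc_Gamma (c i) *m beta) p 0].

Lemma slopes_lbound : lbound slopes 0.
Proof. by move=> _ [i [p ->]]; exact: ltW. Qed.

(** The slopes are indexed by a finite type of pairs, nonempty because of [p], so the infimum is at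
    least an attained positive minimum. *)
Lemma inf_slopes_gt0 i (p : 'I_(sc_dim (c i))) : 0 < inf slopes.
Proof.
pose g (k : {i : 'I_n & 'I_(sc_dim (c i))}) : R :=
  (sc_Gamma (c (tag k)) *m beta) (tagged k) 0.
pose k0 := [arg min_(k < Tagged (fun i => 'I_(sc_dim (c i))) p) g k]%O.
apply: lt_le_trans (Hbeta (tagged k0)) _; rewrite -/(g k0).
apply: lb_le_inf; first by exists ((sc_Gamma (c i) *m beta) p 0), i, p.
move=> _ [i' [p' ->]]; rewrite /k0; case: arg_minP => // k _ Hk.
exact: (Hk (Tagged (fun i => 'I_(sc_dim (c i))) p')).
Qed.

Lemma cf_const_ge0 (f : F) : 0 <= cf_const c beta f.
Proof.
apply: divr_ge0; first by apply: bigmax_ge_id.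
(* Without any constraint the set of slopes is empty and its infimum is 0 by convention. *)
rewrite -/slopes; have [->|/set0P ne] := eqVneq slopes set0; first by rewrite inf0.
apply: lb_le_inf => //; exact: slopes_lbound.
Qed.

Lemma cf_const_slope (f : F) i (p : 'I_(sc_dim (c i))) :
  `|f - sc_f0 (c i)| <= cf_const c beta f * (sc_Gamma (c i) *m beta) p 0.
Proof.
have i0 := inf_slopes_gt0 p.
have le1 : inf slopes <= (sc_Gamma (c i) *m beta) p 0.
  apply: ge_inf; last by exists i, p.
  by exists 0; exact: slopes_lbound.
rewrite /cf_const -/slopes mulrAC ler_pdivlMr //.
apply: ler_pM => //; first exact: ltW.
exact: (le_bigmax _ (fun i => `|f - sc_f0 (c i)|)).
Qed.

End Constants.

Section EtaInf.
Variables (R : realType) (d Q s B n : nat) (X : set 'rV[R]_d).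
Variables (K : 'rV[R]_d -> 'rV[R]_d -> 'M[R]_Q) (F : rkhs X K).
Variables (N : 'rV[R]_d -> R) (c : 'I_n -> shape_constraint F s B).
Variables (Isoc Iom : {set 'I_n}) (M : 'I_n -> nat).
Variables (xt : forall i, 'I_(M i) -> 'rV[R]_d)
  (delta : forall i, 'I_(M i) -> R) (o : forall i, 'I_(M i) -> omega_data R F).
Local Notation eta := (eta_inf N c Isoc Iom xt delta o).

Lemma eta_inf_ge0 : (0 <= eta)%E.
Proof. by rewrite le_max; apply/orP; left; exact: bigmax_ge_id. Qed.

Lemma soc_eta_le i (m : 'I_(M i)) : i \in Isoc ->
  (soc_eta N (c i) (xt m) (delta m) <= eta)%E.
Proof.
move=> iI; rewrite le_max; apply/orP; left.
apply: (@bigmax_sup _ _ _ _ i) => //.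
exact: (@bigmax_sup _ _ _ _ m).
Qed.

Lemma ediam_le i (m : 'I_(M i)) : i \in Iom ->
  (ediam (omega_set (o m)) <= eta)%E.
Proof.
move=> iI; rewrite le_max; apply/orP; right.
apply: (@bigmax_sup _ _ _ _ i) => //.
exact: (@bigmax_sup _ _ _ _ m).
Qed.

End EtaInf.

(** * Comparison of the two optimal values *)

Theorem proposition7 (R : realType) (d Q s B n : nat)
    (N : 'rV[R]_d -> R) (HN : is_norm N)
    (X : set 'rV[R]_d) (HX : X `<=` closure (interior X))
    (K : 'rV[R]_d -> 'rV[R]_d -> 'M[R]_Q)
    (HK : is_kernel X K) (HKs : kernel_Css s X K)
    (F : rkhs X K)
    (* original constraints *)
    (c : 'I_n -> shape_constraint F s B)
    (Hc : forall i, shape_constraint_wf (c i))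
    (Isoc Iom : {set 'I_n})
    (Hdisj : Isoc :&: Iom = finset.set0) (Hcover : forall i, i \in Isoc :|: Iom)
    (Hdim1 : forall i, i \in Iom -> sc_dim (c i) = 1%N)
    (* tightened constraints *)
    (M : 'I_n -> nat)
    (xt : forall i, 'I_(M i) -> 'rV[R]_d) (delta : forall i, 'I_(M i) -> R)
    (Hsoc : forall i, i \in Isoc -> soc_cover N (c i) (@xt i) (@delta i))
    (o : forall i, 'I_(M i) -> omega_data R F)
    (Hom : forall i, i \in Iom -> omega_cover (c i) (@o i))
    (* every set of the covering of Phi_{D_i}(K_i) meets Phi_{D_i}(K_i) *)
    (Hmeet : forall i, i \in Iom -> forall m,
       closure (omega_set (o i m)) `&` Phi_set (c i) !=set0)
    (* optimization problems *)
    (Fhat : set F) (HFhat : closed_subspace Fhat)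
    (L : F * 'cV[R]_B -> \bar R) (HL : forall z, L z != -oo%E)
    (fapp : F) (bapp : 'cV[R]_B) (fbar : F) (bbar : 'cV[R]_B)
    (* (i) *)
    (Happ : is_minimizer L
       [set z | Fhat z.1 /\ C_app N c Isoc Iom xt delta o z] (fapp, bapp))
    (Hbar : is_minimizer L (C_orig c) (fbar, bbar))
    (* (ii) *)
    (HFhatT : Fhat = [set: F])
    (Hdom : [set b | (L (fbar, b) < +oo)%E] = [set: 'cV[R]_B])
    (* (iii) *)
    (beta : 'cV[R]_B)
    (Hbeta : forall i (p : 'I_(sc_dim (c i))), 0 < (sc_Gamma (c i) *m beta) p 0)
    (* (iv) *)
    (Hxt : forall i, i \in Isoc -> forall m, sc_set (c i) (xt i m))
    (* (v) *)
    (Lb : R)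
    (HLip : forall b1 b2 : 'cV[R]_B,
       ((enorm (b1 - bbar))%:E <=
          eta_inf N c Isoc Iom xt delta o *
          (cf_const c beta fbar * enorm beta)%:E)%E ->
       ((enorm (b2 - bbar))%:E <=
          eta_inf N c Isoc Iom xt delta o *
          (cf_const c beta fbar * enorm beta)%:E)%E ->
       (`| L (fbar, b1) - L (fbar, b2) | <= (Lb * enorm (b1 - b2))%:E)%E) :
  let v_app :=
    optval L [set z | Fhat z.1 /\ C_app N c Isoc Iom xt delta o z] in
  let v_bar := optval L (C_orig c) in
  (0 <= v_app - v_bar)%E /\
  ((eta_inf N c Isoc Iom xt delta o < +oo)%E ->
   (v_app - v_bar <=
      (Lb * cf_const c beta fbar * enorm beta)%:E *
      eta_inf N c Isoc Iom xt delta o)%E).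
Proof.
move=> vapp vbar; rewrite /vapp /vbar.
rewrite (is_minimizer_optval Happ) (is_minimizer_optval Hbar).
have cX i : sc_set (c i) `<=` X by have [] := Hc i.
(* [HL] excludes the value -oo and [Hdom] the value +oo, so subtracting values of [L] at [fbar] is
   meaningful. *)
have fin_bar b : L (fbar, b) \is a fin_num.
  rewrite fin_numE HL /= -ltey.
  by have : [set b | (L (fbar, b) < +oo)%E] b by rewrite Hdom.
have C_app_orig z : C_app N c Isoc Iom xt delta o z -> C_orig c z.
  move=> [Hs Ho] i x cx; have := Hcover i; rewrite inE => /orP[iI|iI].
    exact: (C_soc_sub HX HK HKs (cX i) (Hsoc i iI) (Hs i iI) cx).
  exact: (C_omega_sub HX HK HKs (Hdim1 i iI) (cX i) (Hom i iI) (Ho i iI) cx).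
split.
  rewrite sube_ge0 ?fin_bar ?orbT //; apply: Hbar.2.
  by apply: C_app_orig; have [[_]] := Happ.
move=> eta_fin; set eta := eta_inf _ _ _ _ _ _ _ in eta_fin HLip *.
have eta0 : (0 <= eta)%E by exact: eta_inf_ge0.
have etaE : eta = (fine eta)%:E by rewrite fineK // ge0_fin_numE.
have e0 : 0 <= fine eta by exact: fine_ge0.
have cf0 := cf_const_ge0 Hbeta fbar.
set k := cf_const c beta fbar in cf0 HLip *.
(* Finiteness of [eta] makes this a genuine vector. It lies exactly on the boundary of the closed
   ball of the Lipschitz hypothesis. *)
pose b' := bbar + (fine eta * k) *: beta.
have app' : C_app N c Isoc Iom xt delta o (fbar, b').
  split=> i iI.
    apply: (C_soc_shift HN (Hsoc i iI)) => // [m|m|p].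
    - by apply: Hbar.1; exact: Hxt.
    - by rewrite -etaE; exact: soc_eta_le.
    - exact: cf_const_slope.
  apply: (C_omega_shift HX HK HKs (Hdim1 i iI) (cX i) (Hom i iI)) => // [m|x|m|p].
  - exact: Hmeet.
  - exact: Hbar.1.
  - by rewrite -etaE; exact: ediam_le.
  - exact: cf_const_slope.
have Lapp : (L (fapp, bapp) <= L (fbar, b'))%E.
  by apply: Happ.2; split=> //=; rewrite HFhatT.
have nb : enorm (b' - bbar) = fine eta * (k * enorm beta).
  have -> : b' - bbar = (fine eta * k) *: beta by rewrite /b' addrC addKr.
  by rewrite enormZ ger0_norm -?mulrA // mulr_ge0.
have n0 : enorm (bbar - bbar) = 0.
  by rewrite subrr -(scale0r bbar) enormZ normr0 mul0r.
have b0 : 0 <= enorm beta by exact: sqrtr_ge0.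
have := HLip b' bbar; rewrite nb n0 etaE -EFinM !lee_fin lexx.
rewrite (mulr_ge0 e0 (mulr_ge0 cf0 b0)) => /(_ isT isT) HL'.
rewrite -EFinM.
apply: (@le_trans _ _ (L (fbar, b') - L (fbar, bbar))%E).
  exact: leeB Lapp (lexx _).
apply: le_trans (lee_abs _) _; apply: le_trans HL' _.
by rewrite lee_fin le_eqVlt; apply/orP; left; apply/eqP; ring.
Qed.
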